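(* Let $K$ be an infinite field of characteristic different from $2$ and $3$, and let $A=Ke\oplus U\oplus V$ be a finitely generated Bernstein algebra over $K$ such that the operators $L_x:N\to N$ satisfy $L_x^3=0$ for all $x\in N=\ker(\omega)$. Then $A$ is finite-dimensional and $N$ is nilpotent.
   Context: Algebras are not assumed associative, unital or finite-dimensional. A Bernstein algebra over $K$ is a commutative $K$-algebra $A$ with a nonzero algebra homomorphism $\omega:A\to K$ satisfying $(x^2)^2=\omega(x)^2x^2$ for all $x$. $A=Ke\oplus U\oplus V$ is the Peirce decomposition relative to a nonzero idempotent $e$: $U=\{u\in A:2eu=u\}$, $V=\{v\in A:ev=0\}$, $\ker\omega=U\oplus V$. $L_x(y)=xy$. Finitely generated means generated as an algebra by a finite subset. An algebra $N$ is nilpotent if $N^n=0$ for some $n$, where $N^1=N$ and $N^n=\sum_{i+j=n}N^iN^j$. *)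

(* Defs.v *)
From HB Require Import structures.
From mathcomp Require Import all_boot all_order all_algebra.
From mathcomp Require Import sesquilinear.
From mathcomp Require Import boolp classical_sets cardinality.

Set Implicit Arguments.
Unset Strict Implicit.
Unset Printing Implicit Defensive.

Import GRing.Theory.

Local Open Scope classical_set_scope.
Local Open Scope ring_scope.

(* A not necessarily associative or unital K-algebra is an lmodType K together
   with a bilinear multiplication [mul]. *)

Section LinearSets.
Context {K : fieldType} {A : lmodType K}.
Implicit Types S : set A.

Definition is_subspace S : Prop :=
  S 0 /\ forall (a : K) x y, S x -> S y -> S (a *: x + y).

Definition linear_span S : set A := smallest is_subspace S.

Definition finite_dimensional (V : lmodType K) : Prop :=
  exists n : nat, inhabited (Vector.axiom n V).

End LinearSets.

Section Algebras.
Context {K : fieldType} {A : lmodType K}.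
Implicit Types (mul : {bilinear A -> A -> A}) (omega : {scalar A}) (S N : set A).

Definition is_subalgebra mul S : Prop :=
  is_subspace S /\ forall x y, S x -> S y -> S (mul x y).

Definition finitely_generated mul : Prop :=
  exists G : set A, finite_set G /\ smallest (is_subalgebra mul) G = setT.

Definition bernstein mul omega : Prop :=
  [/\ commutative mul,
      forall x y, omega (mul x y) = omega x * omega y,
      exists x, omega x != 0
    & forall x, mul (mul x x) (mul x x) = omega x ^+ 2 *: mul x x].

Definition alg_ker omega : set A := [set x | omega x = 0].

Definition idempotent_elt mul (e : A) : Prop := mul e e = e.

Definition peirceU mul (e : A) : set A := [set u | mul e u *+ 2 = u].
Definition peirceV mul (e : A) : set A := [set v | mul e v = 0].

(* For a subspace N, [alg_power mul N n] is N^n when 0 < n: the least family of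
   subspaces with N included in N^1 and N^i N^j included in N^(i+j).  Lemmas
   [alg_power1] and [alg_powerE] below recover the usual recursion.  Since
   0 < i, j is imposed, [alg_power mul N 0] is the junk value 0. *)
Inductive alg_power mul N : nat -> A -> Prop :=
| AlgPowerBase x : N x -> alg_power mul N 1 x
| AlgPowerMul i j x y : (0 < i)%N -> (0 < j)%N ->
    alg_power mul N i x -> alg_power mul N j y ->
    alg_power mul N (i + j) (mul x y)
| AlgPower0 n : alg_power mul N n 0
| AlgPowerLin n a x y : alg_power mul N n x -> alg_power mul N n y ->
    alg_power mul N n (a *: x + y).

Definition nilpotent_alg mul N : Prop :=
  exists2 n : nat, (0 < n)%N & forall x, alg_power mul N n x -> x = 0.

Lemma alg_power1 mul N : is_subspace N -> alg_power mul N 1 = N.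
Proof.
move=> [N0 NL]; apply/seteqP; split=> x /=; last exact: AlgPowerBase.
move En: 1%N => n Hx; elim: Hx En => {n x} // [i j x y i0 j0 _ _ _ _|n a x y _ IHx _ IHy] En.
  by case: i j i0 j0 En => [|[|i]] [|j].
by apply: NL; [exact: IHx|exact: IHy].
Qed.

Lemma alg_powerE mul N n : (1 < n)%N ->
  alg_power mul N n = linear_span [set z | exists i j x y,
    [/\ (0 < i)%N, (0 < j)%N, (i + j)%N = n &
        [/\ alg_power mul N i x, alg_power mul N j y & z = mul x y]]].
Proof.
move=> n1; apply/seteqP; split=> x /=; last first.
  apply; split; first by split; [exact: AlgPower0|exact: AlgPowerLin].
  by move=> _ [i [j [y [z [i0 j0 <- [Hy Hz ->]]]]]]; exact: AlgPowerMul.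
move=> Hx; elim: Hx n1 => {n x} [|i j x y i0 j0 Hx _ Hy _|n|n a x y _ IHx _ IHy] // n1.
- by move=> M [_]; apply; exists i, j, x, y.
- by move=> M [[]].
- move=> M HM; case: (HM) => -[_ ML] _; apply: ML.
    exact: IHx n1 _ HM.
  exact: IHy n1 _ HM.
Qed.

(* Every nonzero idempotent e of a Bernstein algebra yields the Peirce
   decomposition A = Ke + U + V, which is direct, with ker omega = U + V; it
   therefore never has to be assumed separately. *)
Section Peirce.
Context (mul : {bilinear A -> A -> A}) (omega : {scalar A}) (e : A).
Context (K2 : 2%N \notin [pchar K]) (K3 : 3%N \notin [pchar K]).
Context (bA : bernstein mul omega) (e0 : e != 0) (ee : idempotent_elt mul e).

Let n2 : 2 != 0 :> K. Proof. by move: K2; rewrite inE /=. Qed.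
Let n3 : 3 != 0 :> K. Proof. by move: K3; rewrite inE /=. Qed.

Let div2 (x : A) : x *+ 2 = 0 -> x = 0.
Proof.
by rewrite -scaler_nat => /eqP; rewrite scaler_eq0 (negPf n2) => /eqP.
Qed.

Lemma bernstein_omega_idem : omega e = 1.
Proof.
have [_ oM _ B] := bA; have := B e; rewrite !ee => He.
have : omega e * omega e = omega e by rewrite -oM ee.
have [oe0 _|oe0] := eqVneq (omega e) 0.
  by move: He e0; rewrite oe0 expr0n scale0r => ->; rewrite eqxx.
by rewrite -[RHS]mulr1 => /(mulfI oe0).
Qed.

Let peirce_aux y : omega y = 0 ->
  let d := mul e y *+ 2 in let z := mul y y in mul e d *+ 2 + mul z d *+ 2 = d.
Proof.
have [mC _ _ B] := bA.
have H w : omega w = 0 -> let r := mul e w *+ 2 + mul w w in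
    mul e r *+ 2 + mul r r = r.
  move=> w0 /=; move Er: (mul e w *+ 2 + mul w w) => r; have := B (e + w).
  have -> : omega (e + w) = 1 by rewrite linearD /= w0 addr0 bernstein_omega_idem.
  rewrite expr1n scale1r.
  have -> : mul (e + w) (e + w) = e + r.
    by rewrite linearDl !linearDr ee /= (mC w e) -Er mulr2n !addrA.
  rewrite linearDl !linearDr ee /= (mC r e) -!addrA => /addrI.
  by rewrite addrA -mulr2n.
have split_parity d z : mul e (d + z) *+ 2 + mul (d + z) (d + z) =
    (mul e d *+ 2 + mul z d *+ 2) + (mul e z *+ 2 + (mul d d + mul z z)).
  rewrite linearDl !linearDr /= (mC d z) !mulr2n.
  by rewrite [LHS](AC ((2*2)*(2*2)) (((1*3)*(6*7))*((2*4)*(5*8))))%AC.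
move=> y0 d z; have := H _ y0; rewrite /= -/d -/z split_parity.
have ny0 : omega (- y) = 0 by rewrite linearN /= y0 oppr0.
have := H _ ny0; rewrite /= !linearNr !linearNl opprK mulNrn -/d -/z split_parity.
rewrite !linearNr /= !linearNl opprK !mulNrn -opprD.
set h := _ + mul z d *+ 2; set g := (X in - h + X) => H2 H1.
apply/subr0_eq/div2.
have : (h + g) - (- h + g) = (d + z) - (- d + z) by rewrite H1 H2.
have odd_part (a b : A) : (a + b) - (- a + b) = a *+ 2.
  by rewrite opprD opprK addrACA subrr addr0 mulr2n.
by rewrite !odd_part mulrnBl => ->; rewrite subrr.
Qed.

Lemma bernstein_peirce :
  [/\ forall x, exists a u v,
        [/\ peirceU mul e u, peirceV mul e v & x = a *: e + u + v],
      forall a u v, peirceU mul e u -> peirceV mul e v ->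
        a *: e + u + v = 0 -> [/\ a = 0, u = 0 & v = 0]
    & alg_ker omega = [set x | exists u v,
        [/\ peirceU mul e u, peirceV mul e v & x = u + v]]].
Proof.
have oe := bernstein_omega_idem; have [mC oM _ B] := bA.
have oU u : peirceU mul e u -> omega u = 0.
  move=> /(congr1 omega); rewrite raddfMn /= oM oe mul1r mulr2n.
  by rewrite -[RHS]addr0 => /addrI.
have oV v : peirceV mul e v -> omega v = 0.
  by move=> /(congr1 omega); rewrite oM oe mul1r linear0.
have key y : omega y = 0 -> peirceU mul e (mul e y *+ 2).
  move=> y0; have H1 := peirce_aux y0.
  have /peirce_aux : omega (y *+ 2) = 0 by rewrite raddfMn /= y0 mul0rn.
  have -> : mul e (y *+ 2) *+ 2 = mul e y *+ 2 *+ 2 by rewrite (raddfMn (mul e)).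
  have -> : mul (y *+ 2) (y *+ 2) = mul y y *+ 4.
    by rewrite (raddfMn (mul _)) /= mC (raddfMn (mul y)) /= -mulrnA.
  move: H1; rewrite /peirceU /=; move: (mul e y *+ 2) (mul y y) => d z H1.
  rewrite (raddfMn (mul e)) (raddfMn (mul _)) /= (mC (z *+ 4) d) (raddfMn (mul d)) /=.
  rewrite (mC d z) -[X in _ = X *+ 2]H1 (mulrnDl 2 (mul e d *+ 2) (mul z d *+ 2)) => /addrI /eqP.
  rewrite -!mulrnA -subr_eq0 -mulrnBr //= -[_ *+ _]scaler_nat scaler_eq0.
  have /negPf -> : (12%:R : K) != 0 by rewrite -[12%N]/(2 * 2 * 3)%N !natrM !mulf_neq0.
  by move=> /eqP q0; move: H1; rewrite q0 mul0rn addr0.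
have dec y : omega y = 0 -> exists u v,
    [/\ peirceU mul e u, peirceV mul e v & y = u + v].
  move=> y0; exists (mul e y *+ 2), (y - mul e y *+ 2); split; first exact: key.
    rewrite /peirceV /= linearBr /=; apply: div2.
    by rewrite mulrnBl (key _ y0) subrr.
  by rewrite addrC subrK.
split.
- move=> x; have /dec [u [v [Hu Hv E]]] : omega (x - omega x *: e) = 0.
    by rewrite linearB linearZ /= oe mulr1 subrr.
  by exists (omega x), u, v; split=> //; rewrite -addrA -E addrC subrK.
- move=> a u v Hu Hv E.
  have a0 : a = 0.
    have := congr1 omega E.
    by rewrite !linearD linearZ /= oe (oU _ Hu) (oV _ Hv) linear0 mulr1 !addr0.
  move: E; rewrite a0 scale0r add0r => E.
  have u0 : u = 0.
    have := congr1 (mul e) E; rewrite linearDr linear0r /= Hv addr0 => eu.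
    by rewrite -Hu eu mul0rn.
  by split=> //; move: E; rewrite u0 add0r.
- apply/seteqP; split=> x /=; first exact: dec.
  by case=> u [v [Hu Hv ->]]; rewrite /alg_ker /= linearD /= oU ?oV ?addr0.
Qed.

End Peirce.

End Algebras.

(* Main.v *)
(* Let N = ker omega = U + V and let I be the annihilator of U in U.  In every
   Bernstein algebra V^2 <= I and N / I satisfies x^3 = 0, so that there
   L_(xy) = - (L_x L_y + L_y L_x); in particular the operators L_v, v in V,
   anticommute on U / I.  Filter U / I by the number k of factors L_v, v in V,
   and grade by the degree in homogeneous generators.  Multiplications by the
   finitely many generators in U anticommute modulo the next steps of the
   filtration, so V is spanned, up to elements that count as two factors, by
   finitely many v; as the L_v anticommute, the k-th step equals the next one
   for large k, hence is zero since k cannot exceed the degree.  This bounds the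
   degrees occurring in U / I and therefore in V.  Finally, L_x^3 = 0 gives
   L_v^2 L_w = 0 on U for v, w in V, so long products of the L_v vanish on U
   itself, and the degrees occurring in U are bounded too. *)

Require Import Defs.
From HB Require Import structures.
From mathcomp Require Import all_boot all_order all_algebra.
From mathcomp Require Import sesquilinear zify.
From mathcomp Require Import boolp classical_sets cardinality.
Import GRing.Theory.
Local Open Scope classical_set_scope.
Local Open Scope ring_scope.

(** * Subspaces and linear spans *)

Section Subspaces.
Context {K : fieldType} {A : lmodType K}.
Implicit Types (S P X Y : set A) (x y : A).

Lemma subspace0 S : is_subspace S -> S 0. Proof. by case. Qed.

Lemma subspaceZ S a x : is_subspace S -> S x -> S (a *: x).
Proof. by case=> S0 SL Sx; rewrite -[_ *: _]addr0; apply: SL. Qed.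

Lemma subspaceD S x y : is_subspace S -> S x -> S y -> S (x + y).
Proof. by case=> S0 SL Sx Sy; rewrite -[x]scale1r; apply: SL. Qed.

Lemma subspaceN S x : is_subspace S -> S x -> S (- x).
Proof. by move=> HS Sx; rewrite -scaleN1r; apply: subspaceZ. Qed.

Lemma subspaceB S x y : is_subspace S -> S x -> S y -> S (x - y).
Proof. by move=> HS Sx Sy; apply: subspaceD => //; apply: subspaceN. Qed.

Lemma span_subspace S : is_subspace (linear_span S).
Proof.
split=> [M [[M0 _] _] //|a x y Hx Hy M HM].
by case: (HM) => -[_ ML] _; apply: ML; [apply: Hx|apply: Hy].
Qed.

Lemma mem_span S x : S x -> linear_span S x.
Proof. by move=> Sx M [_]; apply. Qed.

Lemma span_min S P : is_subspace P -> (forall x, S x -> P x) ->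
  forall x, linear_span S x -> P x.
Proof. by move=> HP SP x; apply; split. Qed.

Lemma span_mono S P : (forall x, S x -> P x) ->
  forall x, linear_span S x -> linear_span P x.
Proof.
by move=> SP; apply: span_min => [|x /SP]; [exact: span_subspace|exact: mem_span].
Qed.

Lemma subspace_preim (f : A -> A) P :
  linear f -> is_subspace P -> is_subspace [set x | P (f x)].
Proof.
move=> lf [P0 PL]; split=> [|a x y Px Py] /=; last by rewrite lf; apply: PL.
by have := lf (-1) 0 0; rewrite scaler0 addr0 scaleN1r addNr => ->.
Qed.

Lemma zero_subspace : is_subspace [set (0 : A)].
Proof. by split=> [|a x y -> ->] //=; rewrite scaler0 addr0. Qed.

End Subspaces.

(** * Words of left multiplications with anticommuting letters *)

Section Words.
Context {K : fieldType} {A : lmodType K} (mul : {bilinear A -> A -> A}).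

Lemma mul_linearl x : linear (mul x).
Proof. by move=> a y z; rewrite linearPr. Qed.

Lemma mul_linearr x : linear (fun y => mul y x).
Proof. by move=> a y z; rewrite linearPl. Qed.

Lemma span_mul (X Y P : set A) : is_subspace P ->
  (forall x y, X x -> Y y -> P (mul x y)) ->
  forall x y, linear_span X x -> linear_span Y y -> P (mul x y).
Proof.
move=> HP XY x y Hx Hy; move: x Hx.
apply: span_min => [|x Xx].
  exact: (subspace_preim (fun x => mul x y)) (mul_linearr y) HP.
move: y Hy; apply: span_min => [|y Yy]; last exact: XY.
exact: (subspace_preim (mul x)) (mul_linearl x) HP.
Qed.

(** Letters are abstract because a letter will be either an element itself or an element paired with
    a degree. The last letter acts first. *)
Definition mul_word {L : Type} (c : L -> A) (l : seq L) (x : A) : A :=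
  foldr (fun a => mul (c a)) x l.

Lemma mul_word_linear (L : Type) (c : L -> A) l : linear (mul_word c l).
Proof. by rewrite /mul_word; elim: l => //= b l IH a x y; rewrite IH linearPr. Qed.

Lemma mul_word_stable (L : eqType) (S : Type) (c : L -> A) (nxt : L -> S -> S)
    (Z : S -> set A) (F l : seq L) s x :
  (forall a s x, a \in F -> Z s x -> Z (nxt a s) (mul (c a) x)) ->
  {subset l <= F} -> Z s x -> Z (foldr nxt s l) (mul_word c l x).
Proof.
move=> ZT lF Zx; elim: l lF => //= a l IH lF.
apply: ZT; first by apply: lF; rewrite inE eqxx.
by apply: IH => b bl; apply: lF; rewrite inE bl orbT.
Qed.

(* Modulo [Z2], two occurrences of a letter can be brought next to each other,
   where they cancel.  The index in [S] carries degrees. *)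
Lemma skew_word (L : eqType) (S : Type) (c : L -> A) (nxt : L -> S -> S)
    (Z Z2 : S -> set A) (F : seq L) :
  2 != 0 :> K ->
  (forall s, is_subspace (Z2 s)) ->
  (forall a b s, nxt a (nxt b s) = nxt b (nxt a s)) ->
  (forall a s x, a \in F -> Z s x -> Z (nxt a s) (mul (c a) x)) ->
  (forall a s x, a \in F -> Z2 s x -> Z2 (nxt a s) (mul (c a) x)) ->
  (forall a b s x, a \in F -> b \in F -> Z s x ->
    Z2 (nxt a (nxt b s)) (mul (c a) (mul (c b) x) + mul (c b) (mul (c a) x))) ->
  forall l s x, {subset l <= F} -> (size F < size l)%N -> Z s x ->
    Z2 (foldr nxt s l) (mul_word c l x).
Proof.
move=> n2 sZ2 nxtC ZT Z2T anti l s x lF Fl Zx.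
have ZW w : {subset w <= F} -> Z (foldr nxt s w) (mul_word c w x).
  by move=> wF; exact: mul_word_stable ZT wF Zx.
have rep a w1 w2 : a \in F -> {subset w1 <= F} -> {subset w2 <= F} ->
    Z2 (foldr nxt s (a :: w1 ++ a :: w2)) (mul_word c (a :: w1 ++ a :: w2) x).
  (* The first [a] moves right through [w1], one letter at a time. Once both copies are adjacent,
     the anticommutator is twice [a (a x)], and 2 is invertible. *)
  move=> aF + w2F; elim: w1 => [|b w1 IH] w1F.
    have := anti a a _ _ aF aF (ZW _ w2F).
    rewrite /= -mulr2n -scaler_nat => H; rewrite -[mul _ _]scale1r.
    by rewrite -(mulVf n2) -scalerA; apply: subspaceZ.
  have bF : b \in F by apply: w1F; rewrite inE eqxx.
  have {}w1F : {subset w1 <= F} by move=> d dw; apply: w1F; rewrite inE dw orbT.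
  have wF : {subset w1 ++ a :: w2 <= F}.
    by move=> d; rewrite mem_cat inE => /or3P[/w1F|/eqP ->|/w2F].
  have := anti a b _ _ aF bF (ZW _ wF); have := Z2T b _ _ bF (IH w1F).
  rewrite /= [X in Z2 X]nxtC => H1 H2.
  by have := subspaceB _ _ _ (sZ2 _) H2 H1; rewrite addrK.
(* A duplicate-free word over [F] is no longer than [F], so [l] repeats a letter and can be cut at
   two occurrences of it. *)
have [ul|/uniqPn] := boolP (uniq l).
  by have := uniq_leq_size ul lF; rewrite leqNgt Fl.
case: l lF Fl => [|a0 l'] // lF Fl; set l := a0 :: l' in lF Fl *.
move=> /(_ a0)[i [j [ij jl Eij]]].
have E1 : l = take i l ++ nth a0 l i :: drop i.+1 l.
  by rewrite -drop_nth ?cat_take_drop // (ltn_trans ij jl).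
have E2 : drop i.+1 l = take (j - i.+1) (drop i.+1 l) ++ nth a0 l i :: drop j.+1 l.
  have -> : nth a0 l i = nth a0 (drop i.+1 l) (j - i.+1) by rewrite nth_drop subnKC.
  have -> : drop j.+1 l = drop (j - i.+1).+1 (drop i.+1 l).
    by rewrite drop_drop addSn subnK.
  by rewrite -drop_nth ?cat_take_drop // size_drop ltn_sub2r // (leq_ltn_trans ij jl).
rewrite E1 /mul_word !foldr_cat.
apply: (mul_word_stable _ _ _ _ _ F _ _ _ Z2T); first by move=> d /mem_take /lF.
rewrite E2; apply: rep; first exact: lF (mem_nth _ (ltn_trans ij jl)).
  by move=> d /mem_take /mem_drop /lF.
by move=> d /mem_drop /lF.
Qed.

End Words.

(** * Homogeneous elements of U and V *)

Section PeirceFiltration.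
Context {K : fieldType} {A : lmodType K} (mul : {bilinear A -> A -> A}).
Local Notation "x ** y" := (mul x y) (at level 40, left associativity).

Context (gU gV : seq A).

(** The flag is [true] for U and [false] for V; the degree counts generators. Relations among the
    generators need not be homogeneous, so an element may have several degrees; a family of
    subspaces is used in place of a grading. *)
Inductive homog : bool -> nat -> A -> Prop :=
| HomU x : x \in gU -> homog true 1 x
| HomV x : x \in gV -> homog false 1 x
| HomUU i j p q : homog true i p -> homog true j q -> homog false (i + j) (p ** q)
| HomVU i j v p : homog false i v -> homog true j p -> homog true (i + j) (v ** p)
| HomVV i j v w : homog false i v -> homog false j w -> homog true (i + j) (v ** w)
| Hom0 b n : homog b n 0
| HomLin b n a x y : homog b n x -> homog b n y -> homog b n (a *: x + y).

Lemma hom_eq b m n x : homog b m x -> m = n -> homog b n x.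
Proof. by move=> Hx <-. Qed.

Lemma hom_gt0 b n x : homog b n x -> n = 0 -> x = 0.
Proof.
elim=> {b n x} //.
- by move=> i j p q _ IHp _ IHq; case: i IHp => //= /(_ erefl) -> _; rewrite linear0l.
- by move=> i j p q _ IHp _ IHq; case: i IHp => //= /(_ erefl) -> _; rewrite linear0l.
- by move=> i j p q _ IHp _ IHq; case: i IHp => //= /(_ erefl) -> _; rewrite linear0l.
- by move=> b n a x y _ IHx _ IHy n0; rewrite IHx // IHy // scaler0 addr0.
Qed.

Lemma homU_min n (P : set A) : is_subspace P ->
  (n = 1 -> forall x, x \in gU -> P x) ->
  (forall i j v p, (i + j = n)%N -> homog false i v -> homog true j p -> P (v ** p)) ->
  (forall i j v w, (i + j = n)%N -> homog false i v -> homog false j w -> P (v ** w)) ->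
  forall x, homog true n x -> P x.
Proof.
move=> HP Hg HVU HVV x Hx.
suff: forall b m x, homog b m x -> b = true -> m = n -> P x by apply; eauto.
move=> b m y; elim=> {b m y} //.
- by move=> y gy _ /esym n1; exact: Hg.
- by move=> i j v p Hv _ Hp _ _ ijn; exact: HVU ijn Hv Hp.
- by move=> i j v w Hv _ Hw _ _ ijn; exact: HVV ijn Hv Hw.
- by move=> *; exact: subspace0.
- by move=> b m a y z _ IHy _ IHz bt mn; case: HP => _; apply; [exact: IHy|exact: IHz].
Qed.

Lemma homV_min n (P : set A) : is_subspace P ->
  (n = 1 -> forall x, x \in gV -> P x) ->
  (forall i j p q, (i + j = n)%N -> homog true i p -> homog true j q -> P (p ** q)) ->
  forall x, homog false n x -> P x.
Proof.
move=> HP Hg HUU x Hx.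
suff: forall b m x, homog b m x -> b = false -> m = n -> P x by apply; eauto.
move=> b m y; elim=> {b m y} //.
- by move=> y gy _ /esym n1; exact: Hg.
- by move=> i j p q Hp _ Hq _ _ ijn; exact: HUU ijn Hp Hq.
- by move=> *; exact: subspace0.
- by move=> b m a y z _ IHy _ IHz bt mn; case: HP => _; apply; [exact: IHy|exact: IHz].
Qed.

(** Induction on the degree: there are finitely many generators, and any other product has factors
    of smaller degree. A table [f] of spanning lists for all degrees up to [n] is built, since
    products draw on all of them. *)
Lemma hom_fin b n : exists l : seq A,
  (forall x, x \in l -> homog b n x) /\
  (forall x, homog b n x -> linear_span [set y | y \in l] x).
Proof.
suff [f Hf] : exists f : bool -> nat -> seq A, forall b i, (i < n.+1)%N ->
    (forall x, x \in f b i -> homog b i x) /\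
    (forall x, homog b i x -> linear_span [set y | y \in f b i] x).
  by exists (f b n); exact: Hf.
elim: {b n}(n.+1) => [|n [f Hf]]; first by exists (fun _ _ => [::]).
(* Only left degrees from 1 to [n - 1] are listed: a factor of degree 0 is zero by [hom_gt0]. *)
pose prods b1 b2 := flatten
  [seq [seq x ** y | x <- f b1 i, y <- f b2 (n - i)%N] | i <- iota 1 n.-1].
have prodsP b1 b2 z : z \in prods b1 b2 -> exists i j x y,
    [/\ (i + j = n)%N, homog b1 i x, homog b2 j y & z = x ** y].
  case/flatten_mapP=> i; rewrite mem_iota => Hi /allpairsP[[x y] /= [Hx Hy ->]].
  exists i, (n - i)%N, x, y; split=> //; first by lia.
    by apply: (Hf b1 i _).1 => //; lia.
  by apply: (Hf b2 (n - i)%N _).1 => //; lia.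
have prods_span b1 b2 (s : seq A) i j x y : {subset prods b1 b2 <= s} ->
    (i + j = n)%N -> homog b1 i x -> homog b2 j y ->
    linear_span [set z | z \in s] (x ** y).
  move=> ss ijn Hx Hy; case: i => [|i] in Hx ijn.
    by rewrite (hom_gt0 _ _ _ Hx) // linear0l; exact: subspace0 (span_subspace _).
  case: j => [|j] in Hy ijn.
    by rewrite (hom_gt0 _ _ _ Hy) // linear0r; exact: subspace0 (span_subspace _).
  have := (Hf b2 j.+1 _).2 _ Hy; have := (Hf b1 i.+1 _).2 _ Hx.
  move=> /(_ ltac:(lia)) Hx' /(_ ltac:(lia)) Hy'; move: x y Hx' Hy' {Hx Hy}.
  apply: span_mul => [|x y Hx Hy]; first exact: span_subspace.
  apply: mem_span; apply: ss; apply/flatten_mapP; exists i.+1.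
    by rewrite mem_iota; lia.
  apply/allpairsP; exists (x, y); split=> //=.
  by have -> : (n - i.+1 = j.+1)%N by lia.
pose new (b : bool) := (if n == 1 then if b then gU else gV else [::]) ++
  (if b then prods false true ++ prods false false else prods true true).
exists (fun b i => if i == n then new b else f b i) => b i.
rewrite ltnS leq_eqVlt; case: eqVneq => [->{i} _|_] /=; last exact: Hf.
split=> x.
  rewrite mem_cat => /orP[].
    by case: (eqVneq n 1) => // ->; case: b; [exact: HomU|exact: HomV].
  case: b; first rewrite mem_cat => /orP[].
  - by case/prodsP=> i [j [y [z [<- Hy Hz ->]]]]; exact: HomVU.
  - by case/prodsP=> i [j [y [z [<- Hy Hz ->]]]]; exact: HomVV.
  - by case/prodsP=> i [j [y [z [<- Hy Hz ->]]]]; exact: HomUU.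
have gens y : n = 1 -> y \in (if b then gU else gV) -> linear_span [set z | z \in new b] y.
  by move=> n1 gy; apply: mem_span; rewrite /= /new n1 eqxx mem_cat gy.
case: b gens => gens.
  apply: homU_min => [|n1 y|i j v p|i j v w]; first exact: span_subspace.
  - exact: gens.
  - by apply: prods_span => z Hz; rewrite !mem_cat Hz orbT.
  - by apply: prods_span => z Hz; rewrite !mem_cat Hz !orbT.
apply: homV_min => [|n1 y|i j v p]; first exact: span_subspace.
- exact: gens.
- by apply: prods_span => z Hz; rewrite mem_cat Hz orbT.
Qed.

(** Provides the finite alphabet for [skew_word]. An element does not determine its degree, so each
    letter records one. *)
Lemma homV_letters n : exists F : seq (A * nat),
  (forall a, a \in F -> homog false a.2 a.1) /\
  (forall i v, (i < n)%N -> homog false i v -> linear_span [set x | (x, i) \in F] v).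
Proof.
elim: n => [|n [F [FH Fspan]]]; first by exists [::].
have [l [lH lspan]] := hom_fin false n.
exists ([seq (x, n) | x <- l] ++ F); split.
  by move=> a; rewrite mem_cat => /orP[/mapP[x /lH Hx ->]|/FH].
move=> i v; rewrite ltnS leq_eqVlt => /orP[/eqP ->|lin] Hv.
  apply: span_mono (lspan _ Hv) => x /= Hx.
  by rewrite mem_cat map_f.
by apply: span_mono (Fspan _ _ lin Hv) => x /= Hx; rewrite mem_cat Hx orbT.
Qed.

(** * The annihilator of U and the filtration modulo it *)

Context (U V : set A).
Context (n2 : 2 != 0 :> K) (mC : commutative mul).
Context (subU : is_subspace U) (subV : is_subspace V).
Context (gUU : forall x, x \in gU -> U x) (gVV : forall x, x \in gV -> V x).
Context (mUU : forall p q, U p -> U q -> V (p ** q)).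
Context (mVU : forall v p, V v -> U p -> U (v ** p)).
Context (mVV : forall v w, V v -> V w -> U (v ** w)).
Context (skewU : forall p q v, U p -> U q -> V v ->
  p ** (v ** q) = - (q ** (v ** p))).
Context (cubeU : forall p q r, U p -> U q -> U r ->
  p ** (q ** r) + q ** (r ** p) + r ** (p ** q) = 0).
Context (annVV : forall p v w, U p -> V v -> V w -> p ** (v ** w) = 0).
Context (skewV : forall p q v w, U p -> U q -> V v -> V w ->
  p ** (v ** (w ** q)) = - (p ** (w ** (v ** q)))).

Definition annU : set A := [set x | U x /\ forall u, U u -> u ** x = 0].

(* Modulo [annU], [filt k n] consists of the elements of degree [n] in [U] that
   are obtained from [U] by at least [k] multiplications by elements of [V]. *)
Fixpoint filt (k n : nat) : set A :=
  if k is k'.+1 then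
    linear_span [set x | annU x \/ exists i j v y,
      [/\ (i + j = n)%N, homog false i v, filt k' j y & x = v ** y]]
  else linear_span [set x | annU x \/ homog true n x].

#[local] Arguments filt : simpl never.

Lemma hom_peirce b n x : homog b n x -> (if b then U else V) x.
Proof.
elim=> {b n x} //=.
- by move=> i j p q _ Up _ Uq; apply: mUU.
- by move=> i j p q _ Up _ Uq; apply: mVU.
- by move=> i j p q _ Up _ Uq; apply: mVV.
- by move=> [] n; apply: subspace0.
- move=> [] n a x y _ Ux _ Uy; first by case: subU => _; apply.
  by case: subV => _; apply.
Qed.

Lemma homU_sub n x : homog true n x -> U x. Proof. exact: hom_peirce. Qed.
Lemma homV_sub n x : homog false n x -> V x. Proof. exact: hom_peirce. Qed.

Lemma subspace_mull (P : set A) p : is_subspace P -> is_subspace (fun x => P (p ** x)).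
Proof. exact: subspace_preim (mul_linearl mul p). Qed.

Lemma subspace_mulr (P : set A) p : is_subspace P -> is_subspace (fun x => P (x ** p)).
Proof. exact: (subspace_preim (fun x => x ** p)) (mul_linearr mul p). Qed.

Lemma annU_subspace : is_subspace annU.
Proof.
split; first by split; [exact: subspace0|move=> u _; rewrite linear0r].
move=> a x y [Ux xU] [Uy yU]; split; first by case: subU => _; apply.
by move=> u Uu; rewrite linearPr xU // yU // scaler0 addr0.
Qed.

(** By [skewU], [u (v x) = - x (v u)], where [v u] lies in U and is annihilated by [x]. *)
Lemma annU_mulV v x : V v -> annU x -> annU (v ** x).
Proof.
move=> Vv [Ux xU]; split=> [|u Uu]; first exact: mVU.
by rewrite skewU // mC xU ?oppr0 //; apply: mVU.
Qed.

Lemma annUr x u : annU x -> U u -> x ** u = 0.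
Proof. by move=> [_ xU] Uu; rewrite mC xU. Qed.

Lemma annU_VV v w : V v -> V w -> annU (v ** w).
Proof. by move=> Vv Vw; split=> [|u Uu]; [apply: mVV|apply: annVV]. Qed.

Lemma annU_skew v w x : V v -> V w -> U x -> annU (v ** (w ** x) + w ** (v ** x)).
Proof.
move=> Vv Vw Ux; split=> [|u Uu].
  by apply: subspaceD => //; apply: mVU => //; apply: mVU.
by rewrite linearDr /= skewV // addNr.
Qed.

(* In [N / annU] one has L_(xy) = - (L_x L_y + L_y L_x); this is that identity
   for x = p and y = v ** q, applied to z. *)
Lemma annU_commute p q z v : U p -> U q -> U z -> V v ->
  annU ((p ** (v ** q)) ** z - (p ** (q ** (v ** z)) + v ** (q ** (p ** z)))).
Proof.
move=> Up Uq Uz Vv; have Uvq := mVU _ _ Vv Uq.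
have := cubeU _ _ _ Up Uvq Uz.
rewrite [v ** q ** z]mC (skewU z q v) // linearNr /=.
rewrite [v ** q ** _]mC [z ** p]mC [z ** _]mC [q ** (p ** z)]mC => E.
have -> : p ** (v ** q) ** z = p ** (q ** (v ** z)) - p ** z ** (v ** q).
  by apply/eqP; rewrite -subr_eq0 -E opprB addrC [X in _ == X + _]addrC.
rewrite opprD addrACA subrr add0r.
rewrite -opprD; apply: subspaceN; first exact: annU_subspace.
by apply: annU_skew => //; apply: mUU.
Qed.

Lemma filt_subspace k n : is_subspace (filt k n).
Proof. by case: k => [|k]; exact: span_subspace. Qed.

Lemma filt_annU k n x : annU x -> filt k n x.
Proof. by case: k => [|k] Hx; apply: mem_span; left. Qed.

Lemma filt_hom n x : homog true n x -> filt 0 n x.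
Proof. by move=> Hx; apply: mem_span; right. Qed.

Lemma filt_mulV k i j v x : homog false i v -> filt k j x -> filt k.+1 (i + j) (v ** x).
Proof. by move=> Hv Hx; apply: mem_span; right; exists i, j, v, x. Qed.

Lemma filt_eq k m n x : filt k m x -> m = n -> filt k n x.
Proof. by move=> Hx <-. Qed.

Lemma filt0_min n (P : set A) : is_subspace P -> (forall x, annU x -> P x) ->
  (forall x, homog true n x -> P x) -> forall x, filt 0 n x -> P x.
Proof. by move=> HP H1 H2; apply: span_min => // x [/H1|/H2]. Qed.

Lemma filtS_min k n (P : set A) : is_subspace P -> (forall x, annU x -> P x) ->
  (forall i j v y, (i + j = n)%N -> homog false i v -> filt k j y -> P (v ** y)) ->
  forall x, filt k.+1 n x -> P x.
Proof.
move=> HP H1 H2; apply: span_min => // x [/H1 //|[i [j [v [y [ij Hv Hy ->]]]]]].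
exact: H2 ij Hv Hy.
Qed.

Lemma filtU k n x : filt k n x -> U x.
Proof.
elim: k n x => [|k IH] n; first by apply: filt0_min => // x; [case|exact: homU_sub].
apply: filtS_min => // [x []//|i j v y _ Hv Hy].
by apply: mVU; [exact: homV_sub Hv|exact: IH Hy].
Qed.

Lemma filt_le1 k n x : filt k.+1 n x -> filt k n x.
Proof.
elim: k n x => [|k IH] n; apply: filtS_min; try exact: filt_subspace.
- exact: filt_annU.
- move=> i j v y <- Hv; move: y; apply: filt0_min => [|x Hx|x Hx].
  + exact: subspace_mull (filt_subspace _ _).
  + by apply: filt_annU; apply: annU_mulV => //; exact: homV_sub Hv.
  + by apply: filt_hom; exact: HomVU.
- exact: filt_annU.
- by move=> i j v y <- Hv /IH Hy; apply: filt_mulV.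
Qed.

(** Nonzero factors from V have positive degree, so more than [n] of them do not fit into degree
    [n]. *)
Lemma filt_deg k n x : (n < k)%N -> filt k n x -> annU x.
Proof.
elim: k n x => // k IH n x nk; apply: filtS_min x; try by [|exact: annU_subspace].
move=> [|i] j v y ij Hv Hy.
  by rewrite (hom_gt0 _ _ _ Hv) // linear0l; apply: subspace0 annU_subspace.
apply: annU_mulV; first exact: homV_sub Hv.
by apply: (IH j) => //; lia.
Qed.

(** For [x = v y], [annU_commute] turns [p (q (v y))] modulo [annU] into
    [(p (v q)) y - v (q (p y))]. The first term has the factor [p (v q)] from V; the second is
    handled by induction with [p] and [q] exchanged. *)
Lemma filt_mulUU k n p q i j : homog true i p -> homog true j q ->
  forall x, filt k n x -> filt k (i + j + n) (p ** (q ** x)).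
Proof.
elim: k n p q i j => [|k IH] n p q i j Hp Hq.
  apply: filt0_min => [|x Hx|x Hx].
  - exact: (subspace_mull _ q (subspace_mull _ p (filt_subspace _ _))).
  - rewrite [q ** x]mC (annUr _ _ Hx (homU_sub _ _ Hq)) linear0r.
    exact: subspace0 (filt_subspace _ _).
  - apply: filt_hom; rewrite mC addnAC -addnA [(n + _)%N]addnC addnC addnAC.
    by apply: hom_eq (HomVU _ _ _ _ (HomUU _ _ _ _ Hq Hx) Hp) _; lia.
apply: filtS_min => [|x Hx|i' j' v y <- Hv Hy].
- exact: (subspace_mull _ q (subspace_mull _ p (filt_subspace _ _))).
- rewrite [q ** x]mC (annUr _ _ Hx (homU_sub _ _ Hq)) linear0r.
  exact: subspace0 (filt_subspace _ _).
- have Hc := annU_commute p q y v (homU_sub _ _ Hp) (homU_sub _ _ Hq)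
    (filtU _ _ _ Hy) (homV_sub _ _ Hv).
  set X := p ** _; have -> : X = (p ** (v ** q)) ** y - v ** (q ** (p ** y))
      - ((p ** (v ** q)) ** y - (X + v ** (q ** (p ** y)))).
    by rewrite opprB addrC addrA addrNK addrK.
  have HS := filt_subspace k.+1 (i + j + (i' + j')).
  apply: (subspaceB _ _ _ HS); last exact: filt_annU.
  apply: (subspaceB _ _ _ HS).
    apply: filt_eq (filt_mulV _ _ _ _ _ (HomUU _ _ _ _ Hp (HomVU _ _ _ _ Hv Hq)) Hy) _.
    by lia.
  apply: filt_eq (filt_mulV _ _ _ _ _ Hv (IH _ _ _ _ _ Hq Hp _ Hy)) _; lia.
Qed.

(** This is the sense in which [p g] counts as two factors from V. The work is in [l = 0], where the
    two V-factors of [g] are extracted with [annU_commute] and [skewU]; for larger [l], [p g] is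
    moved past a factor of [x] by [annU_skew]. *)
Lemma filt_mulVadd2 l i j m p g x : homog true i p -> filt 2 j g -> filt l m x ->
  filt l.+2 (i + j + m) ((p ** g) ** x).
Proof.
move=> Hp Hg; have Up := homU_sub _ _ Hp; have Vpg := mUU _ _ Up (filtU _ _ _ Hg).
elim: l m x => [|l IH] m.
  apply: filt0_min => [|x Hx|z Hz]; first exact: subspace_mull (filt_subspace _ _).
    by apply: filt_annU; apply: annU_mulV.
  have Uz := homU_sub _ _ Hz; move: g Hg {Vpg}.
  apply: filtS_min => [|g Hg|a b v g <- Hv Hg].
  - exact: (subspace_mull _ p (subspace_mulr _ z (filt_subspace _ _))).
  - by rewrite [p ** g]mC (annUr _ _ Hg Up) linear0l; exact: subspace0 (filt_subspace _ _).
  - have Ug := filtU _ _ _ Hg; have Vv := homV_sub _ _ Hv.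
    rewrite -[_ ** z](subrK (p ** (g ** (v ** z)) + v ** (g ** (p ** z)))).
    have HS := filt_subspace 2 (i + (a + b) + m).
    apply: (subspaceD _ _ _ HS); first by apply: filt_annU; exact: annU_commute.
    apply: (subspaceD _ _ _ HS); last first.
      (* The current [g] is in [filt 1] and [p z] is in V, so [v ((p z) g)] is even in [filt 3]. *)
      rewrite [g ** _]mC.
      have := filt_mulV _ _ _ _ _ (HomUU _ _ _ _ Hp Hz) Hg => /filt_le1 H.
      by apply: filt_eq (filt_mulV _ _ _ _ _ Hv H) _; lia.
    have Uvz := mVU _ _ Vv Uz; move: g Hg {HS Ug}.
    apply: filtS_min => [|g Hg|c d w y <- Hw Hy].
    + exact: (subspace_mulr _ (v ** z) (subspace_mull _ p (filt_subspace _ _))).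
    + by rewrite (annUr _ _ Hg Uvz) linear0r; exact: subspace0 (filt_subspace _ _).
    + have Vw := homV_sub _ _ Hw; have Uy := filtU _ _ _ Hy.
      (* Now [p ((w y) (v z)) = - p (y (w (v z)))]: both V-factors act on [z], and [filt_mulUU]
         preserves them under [p] and [y]. *)
      rewrite [w ** y ** _]mC (skewU (v ** z) y w) // linearNr /=.
      apply: (subspaceN _ _ (filt_subspace _ _)).
      move: y Hy {Uy}; apply: filt0_min => [|y Hy|y Hy].
      * exact: (subspace_mulr _ _ (subspace_mull _ p (filt_subspace _ _))).
      * by rewrite (annUr _ _ Hy (mVU _ _ Vw Uvz)) linear0r; exact: subspace0 (filt_subspace _ _).
      * have H := filt_mulV _ _ _ _ _ Hw (filt_mulV _ _ _ _ _ Hv (filt_hom _ _ Hz)).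
        by apply: filt_eq (filt_mulUU _ _ _ _ _ _ Hp Hy _ H) _; lia.
apply: filtS_min => [|x Hx|a b w x <- Hw Hx]; first exact: subspace_mull (filt_subspace _ _).
  by apply: filt_annU; apply: annU_mulV.
rewrite -[_ ** _](addrK (w ** (p ** g ** x))).
have HS := filt_subspace l.+3 (i + j + (a + b)).
apply: (subspaceB _ _ _ HS).
  by apply: filt_annU; apply: annU_skew => //; [exact: homV_sub Hw|exact: filtU Hx].
by apply: filt_eq (filt_mulV _ _ _ _ _ Hw (IH _ _ Hx)) _; lia.
Qed.

(** Allows a filtered element to be replaced by a homogeneous one inside a product with U, where
    [annU] disappears. *)
Lemma filt_hom_mod k n x : filt k n x -> exists2 h, homog true n h & annU (x - h).
Proof.
have sub m : is_subspace (fun x => exists2 h, homog true m h & annU (x - h)).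
  split; first by exists 0; [exact: Hom0|rewrite subrr; exact: subspace0 annU_subspace].
  move=> a y z [h Hh Hy] [h' Hh' Hz]; exists (a *: h + h'); first exact: HomLin.
  by rewrite opprD addrACA -scalerBr; case: annU_subspace => _; apply.
elim: k n x => [|k IH] n; first (apply: filt0_min => // x Hx).
- by exists 0; [exact: Hom0|rewrite subr0].
- by exists x; rewrite // subrr; exact: subspace0 annU_subspace.
apply: filtS_min => // [x Hx|i j v y <- Hv /IH[h Hh Hy]].
  by exists 0; [exact: Hom0|rewrite subr0].
exists (v ** h); first exact: HomVU.
by rewrite -linearBr /=; apply: annU_mulV Hy; exact: homV_sub Hv.
Qed.

Lemma hom_mul_filt k i j p x : homog true i p -> filt k j x -> homog false (i + j) (p ** x).
Proof.
move=> Hp /filt_hom_mod[h Hh [Ux Hx]].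
have := Hx _ (homU_sub _ _ Hp); rewrite linearBr /= => /subr0_eq ->.
exact: HomUU.
Qed.

(** * The part of V that counts as two factors *)

Definition filtV n : set A := linear_span [set x | exists i j p g,
  [/\ (i + j = n)%N, homog true i p, filt 2 j g & x = p ** g]].

Lemma filtV_subspace n : is_subspace (filtV n). Proof. exact: span_subspace. Qed.

Lemma filtV_mul i j p g : homog true i p -> filt 2 j g -> filtV (i + j) (p ** g).
Proof. by move=> Hp Hg; apply: mem_span; exists i, j, p, g. Qed.

Lemma filtV_eq m n x : filtV m x -> m = n -> filtV n x.
Proof. by move=> Hx <-. Qed.

Lemma filtV_mul_filt l i m v x : filtV i v -> filt l m x -> filt l.+2 (i + m) (v ** x).
Proof.
move=> Hv Hx; move: v Hv; apply: span_min.
  exact: subspace_mulr (filt_subspace _ _).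
by move=> _ [a [b [p [g [<- Hp Hg ->]]]]]; apply: filt_mulVadd2.
Qed.

Lemma homU_min_filt n (P : set A) : is_subspace P ->
  (n = 1 -> forall x, x \in gU -> P x) -> (forall x, filt 1 n x -> P x) ->
  forall x, homog true n x -> P x.
Proof.
move=> HP Hg H1; apply: homU_min => // i j v y ijn Hv Hy; apply: H1; rewrite -?ijn.
  exact: filt_mulV Hv (filt_hom _ _ Hy).
by apply: filt_annU; apply: annU_VV; [exact: homV_sub Hv|exact: homV_sub Hy].
Qed.

(** In a product [p q] each factor is a generator or lies in [filt 1], and two generators only reach
    degree 2. A generator [a] times [v y] is, according to [y], zero, of the form [a (b v)], or in
    [filtV]. If both factors lie in [filt 1], [skewU] gathers their V-factors on one side. *)
Lemma homV_min_filt n (P : set A) : (2 < n)%N -> is_subspace P ->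
  (forall x, filtV n x -> P x) ->
  (forall a b m w, m.+2 = n -> a \in gU -> b \in gU -> homog false m w ->
    P (a ** (b ** w))) ->
  forall x, homog false n x -> P x.
Proof.
move=> n_gt2 HP H2 Hgg.
have Pmul a i j v y : a \in gU -> (1 + (i + j) = n)%N -> homog false i v ->
    filt 0 j y -> P (a ** (v ** y)).
  move=> ga En Hv; have Ua := gUU _ ga; have Vv := homV_sub _ _ Hv.
  move: y; apply: filt0_min => [|y Hy|].
  - exact: (subspace_mull _ v (subspace_mull _ a HP)).
  - by have [_ ->] := annU_mulV _ _ Vv Hy; rewrite //; exact: subspace0 HP.
  apply: homU_min_filt => [|j1 y gy|y Hy].
  - exact: (subspace_mull _ v (subspace_mull _ a HP)).
  - by rewrite [v ** y]mC; apply: (Hgg a y i) => //; lia.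
  - by apply: H2; apply: filtV_eq (filtV_mul _ _ _ _ (HomU _ ga)
      (filt_mulV _ _ _ _ _ Hv Hy)) _; lia.
apply: homV_min => // [n1|i j p q En Hp Hq]; first by lia.
move: p Hp; apply: homU_min_filt => [|i1 a ga|p Hp]; first exact: subspace_mulr.
  have Ha := HomU _ ga; move: q Hq.
  apply: homU_min_filt => [|j1 b gb|]; [exact: subspace_mull|by lia|].
  apply: filtS_min => [|x [_ Hx]|k l v y kl Hv Hy]; first exact: subspace_mull.
    by rewrite Hx; [exact: subspace0 HP|exact: gUU].
  by apply: (Pmul _ k l) => //; lia.
have Uq := homU_sub _ _ Hq; move: p Hp.
apply: filtS_min => [|x Hx|k l v y kl Hv Hy]; first exact: subspace_mulr.
  by rewrite annUr //; exact: subspace0 HP.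
have Vv := homV_sub _ _ Hv; rewrite mC.
move: q Hq {Uq}; apply: homU_min_filt => [|j1 a ga|q Hq].
- exact: (subspace_mulr _ (v ** y) HP).
- by apply: (Pmul _ k l) => //; lia.
- have Uq := filtU _ _ _ Hq; rewrite skewU //; last exact: filtU Hy.
  apply: (subspaceN _ _ HP); move: y Hy.
  apply: filt0_min => [|y Hy|y Hy]; first exact: subspace_mulr.
    by rewrite annUr //; [exact: subspace0 HP|exact: mVU].
  by apply: H2; apply: filtV_eq (filtV_mul _ _ _ _ Hy (filt_mulV _ _ _ _ _ Hv Hq)) _; lia.
Qed.

(* Multiplications by the generators in [U] anticommute on [filt 1] and on [V]
   modulo [filt 2] and [filtV]. *)
Lemma homV_filtV n x : ((size gU).+1.*2 < n)%N -> homog false n x -> filtV n x.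
Proof.
(* A state is a component and a degree: a generator in U exchanges U and V and raises the degree by
   1. *)
pose nxt (a : A) (s : bool * nat) := (~~ s.1, s.2.+1).
pose Z (s : bool * nat) := if s.1 then filt 1 s.2 else homog false s.2.
pose Z2 (s : bool * nat) := if s.1 then filt 2 s.2 else filtV s.2.
have sZ2 s : is_subspace (Z2 s).
  by case: s => [[] m]; [exact: filt_subspace|exact: filtV_subspace].
have ZT a s y : a \in gU -> Z s y -> Z (nxt a s) (a ** y).
  move=> ga; have Ha := HomU _ ga; case: s => [[] m]; rewrite /Z /=.
    exact: hom_mul_filt Ha.
  by rewrite mC -(addn1 m) => Hy; exact: filt_mulV Hy (filt_hom _ _ Ha).
have Z2T a s y : a \in gU -> Z2 s y -> Z2 (nxt a s) (a ** y).
  move=> ga; have Ha := HomU _ ga; case: s => [[] m]; rewrite /Z2 /=.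
    exact: filtV_mul Ha.
  move: y; apply: span_min => [|_ [i [j [p [g [<- Hp Hg ->]]]]]].
    exact: subspace_mull (filt_subspace _ _).
  exact: (filt_mulUU 2 j a p 1 i Ha Hp).
have anti a b s y : a \in gU -> b \in gU -> Z s y ->
    Z2 (nxt a (nxt b s)) (a ** (b ** y) + b ** (a ** y)).
  move=> ga gb; have Ua := gUU _ ga; have Ub := gUU _ gb.
  (* On U the anticommutator is [- (a b) y] by [cubeU], which has one more factor from V; on V it is
     zero by [skewU]. *)
  case: s => [[] m]; rewrite /Z /Z2 /= => Hy.
    have /eqP := cubeU _ _ _ Ua Ub (filtU _ _ _ Hy).
    rewrite addr_eq0 [y ** a]mC [y ** _]mC => /eqP ->.
    apply: (subspaceN _ _ (filt_subspace _ _)).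
    exact: filt_mulV (HomUU _ _ _ _ (HomU _ ga) (HomU _ gb)) Hy.
  rewrite [b ** y]mC [a ** y]mC skewU //; last exact: homV_sub Hy.
  by rewrite addNr; exact: subspace0 (filtV_subspace _).
(* Here [e] is the number of pairs of generators still to be split off by [homV_min_filt], each at
   the cost of 2 in degree; [l] collects them until it is longer than [gU]. *)
have main e (l : seq A) m w : {subset l <= gU} -> (size gU < size l + e.*2)%N ->
    (e.*2 < m)%N -> homog false m w ->
    Z2 (foldr nxt (false, m) l) (mul_word mul id l w).
  elim: e l m w => [|e IH] l m w lU.
    rewrite double0 addn0 => szl _ Hw.
    exact: (skew_word mul _ _ id nxt Z Z2 gU n2 sZ2 _ ZT Z2T anti).
  rewrite doubleS => szl em; move: w; apply: homV_min_filt => [|||a b m' w Em ga gb Hw].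
  - by lia.
  - exact: (subspace_preim (mul_word mul id l) _ (mul_word_linear mul _ _ _) (sZ2 _)).
  - by move=> w Hw; exact: (mul_word_stable mul _ _ _ _ _ gU _ _ _ Z2T lU).
  - have := IH (l ++ [:: a; b]) m' w; rewrite /mul_word !foldr_cat /= -Em => H.
    apply: H => //; last by lia.
    + by move=> d; rewrite mem_cat !inE => /or3P[/lU|/eqP ->|/eqP ->].
    + by rewrite size_cat /=; lia.
by move=> szn Hx; apply: (main (size gU).+1 [::] n x) => //=; lia.
Qed.

(** * Stabilisation of the filtration and vanishing in large degree *)

Lemma filt_word k m (F l : seq (A * nat)) y :
  (forall a, a \in F -> homog false a.2 a.1) -> {subset l <= F} -> filt k m y ->
  filt (size l + k) (foldr (fun a n => (a.2 + n)%N) m l) (mul_word mul fst l y).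
Proof.
move=> FH lF Hy; elim: l lF => //= a l IH lF.
apply: filt_mulV; first by apply: FH; apply: lF; rewrite inE eqxx.
by apply: IH => b bl; apply: lF; rewrite inE bl orbT.
Qed.

(* If finitely many elements of [V] span [V] modulo [filtV], any sufficiently
   long product of them is zero modulo [annU], so [filt] is eventually constant;
   being eventually [annU] in every single degree, it is then [annU]. *)
Lemma filt_stable n0 : (forall n x, (n0 <= n)%N -> homog false n x -> filtV n x) ->
  exists T, forall n x, filt T n x -> annU x.
Proof.
move=> HV; have [F [FH Fspan]] := homV_letters n0.
pose nxt (a : A * nat) (n : nat) := (a.2 + n)%N.
have Ub a y : a \in F -> U y -> U (a.1 ** y).
  by move=> /FH /homV_sub Va Uy; apply: mVU.
(* [t] counts the factors from V not yet moved from [y] into the word; the conclusion is one step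
   better than the evident [filt (size l + t)]. *)
have main t (l : seq (A * nat)) m y : {subset l <= F} -> (size F < size l + t)%N ->
    filt t m y -> filt (size l + t).+1 (foldr nxt m l) (mul_word mul fst l y).
  elim: t l m y => [|t IH] l m y lF.
    rewrite addn0 => szl /filtU Uy; apply: filt_annU.
    apply: (skew_word mul _ _ fst nxt (fun _ => U) (fun _ => annU) F n2 _ _ _ _ _ l m) => //.
    - by move=> _; exact: annU_subspace.
    - by move=> a b s; rewrite /nxt addnCA.
    - by move=> a _ x /Ub; apply.
    - by move=> a _ x /FH /homV_sub Va; apply: annU_mulV.
    - by move=> a b _ x /FH /homV_sub Va /FH /homV_sub Vb; apply: annU_skew.
  move=> szl; have lw := subspace_preim (mul_word mul fst l) _ (mul_word_linear mul _ fst l)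
    (filt_subspace (size l + t.+1).+1 (foldr nxt m l)).
  move: y; apply: filtS_min => // [x Hx|i j v y ijm Hv Hy].
    apply: filt_annU.
    apply: (mul_word_stable mul _ _ fst nxt (fun _ => annU) F l m) => //.
    by move=> a _ z /FH /homV_sub Va; apply: annU_mulV.
  (* A factor of degree at least [n0] lies in [filtV] and yields the extra step itself; one of
     smaller degree is a combination of letters and joins the word. *)
  have [ltin|lein] := ltnP i n0; last first.
    have := filt_word _ _ F l _ FH lF (filtV_mul_filt _ _ _ _ _ (HV _ _ lein Hv) Hy).
    by rewrite ijm !addnS.
  have Fv := Fspan _ _ ltin Hv; move: v Fv {Hv}; apply: span_min => [|v Fv].
    exact: (subspace_mulr _ y lw).
  have := IH (rcons l (v, i)) j y.
  rewrite /mul_word !foldr_rcons size_rcons addSnnS /nxt /= ijm; apply=> //.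
  by move=> a; rewrite mem_rcons inE => /predU1P[->|/lF].
exists (size F).+1 => n x Hx.
have stab m : filt ((size F).+1 + m) n x.
  elim: m => [|m IH]; first by rewrite addn0.
  by rewrite addnS; apply: (main ((size F).+1 + m)%N [::] n x) => //=; lia.
by apply: (filt_deg ((size F).+1 + n) n _ _ (stab n)); lia.
Qed.

Lemma homU_annU : exists n1, forall n x, (n1 <= n)%N -> homog true n x -> annU x.
Proof.
pose n0 := (size gU).+1.*2.+1.
have HV n x : (n0 <= n)%N -> homog false n x -> filtV n x by exact: homV_filtV.
have [T HT] := filt_stable n0 HV.
(* A V-factor of degree below [n0] leaves enough degree for induction; one of larger degree lies in
   [filtV] and gains two steps. The 2 excludes generators when [k = 0]. *)
have up k n x : (k * n0 + 2 <= n)%N -> filt k n x -> filt k.+1 n x.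
  elim: k n x => [|k IH] n x kn; move: x.
    apply: filt0_min => [|x Hx|]; [exact: filt_subspace|exact: filt_annU|].
    by apply: homU_min_filt => //; [exact: filt_subspace|lia].
  apply: filtS_min => [|x Hx|i j v y ijn Hv Hy]; first exact: filt_subspace.
    exact: filt_annU.
  have [ltin|lein] := ltnP i n0.
    rewrite -ijn; apply: filt_mulV => //; apply: IH => //; move: kn; rewrite mulSn; lia.
  by rewrite -ijn; apply: filtV_mul_filt => //; exact: HV.
exists (T * n0 + 2)%N => n x Tn Hx; apply: (HT n).
have H k : (k <= T)%N -> filt k n x.
  elim: k => [_|k IH kT]; first exact: filt_hom.
  apply: up; last by apply: IH; lia.
  by apply: leq_trans Tn; rewrite leq_add2r leq_mul2r ltnW ?orbT.
exact: H.
Qed.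

(** One of the two factors from U has degree at least [n1], so it lies in [annU] and kills the
    other. The 2 in the bound excludes generators. *)
Lemma homV_eq0 : exists n1, forall n x, (n1 <= n)%N -> homog false n x -> x = 0.
Proof.
have [n1 H1] := homU_annU; exists (n1.*2 + 2)%N => n x nn; move: x.
apply: homV_min => [||i j p q ijn Hp Hq]; [exact: zero_subspace|by lia|].
have [n1i|n1i] := leqP n1 i; first exact: annUr (H1 _ _ n1i Hp) (homU_sub _ _ Hq).
have n1j : (n1 <= j)%N by lia.
by have [_] := H1 _ _ n1j Hq; apply; exact: homU_sub Hp.
Qed.

(** The hypothesis is the polarised form of [L_v^2 L_t = 0] on U: on [VU] the operators [L_v]
    anticommute exactly, not merely modulo [annU], so long words in finitely many of them vanish
    there. *)
Lemma homU_eq0 :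
  (forall v w t x, V v -> V w -> V t -> U x ->
    v ** (w ** (t ** x)) = - (w ** (v ** (t ** x)))) ->
  exists n1, forall n x, (n1 <= n)%N -> homog true n x -> x = 0.
Proof.
move=> skew3; have [nV HV] := homV_eq0; have [F [FH Fspan]] := homV_letters nV.
pose VU := linear_span [set x | exists t u, [/\ V t, U u & x = t ** u]].
have memVU t u : V t -> U u -> VU (t ** u).
  by move=> Vt Uu; apply: mem_span; exists t, u.
have VUU x : VU x -> U x.
  by apply: span_min => // _ [t [u [Vt Uu ->]]]; apply: mVU.
have homVV0 i j v w : (nV.*2 <= i + j)%N -> homog false i v -> homog false j w -> v ** w = 0.
  move=> ij Hv Hw; have [le|lt] := leqP nV i; first by rewrite (HV _ _ le Hv) linear0l.
  by rewrite (HV j w _ Hw) ?linear0r //; lia.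
(* Each of the [e] factors still to be split off has degree below [nV] or is zero. The reserve
   [2 nV + 2] rules out generators and nonzero products of two elements of V, so [x] always lies in
   [VU]. *)
have main e (l : seq (A * nat)) m x : {subset l <= F} -> (size F < size l + e)%N ->
    (nV.*2 + 2 + e * nV <= m)%N -> homog true m x -> mul_word mul fst l x = 0.
  elim: e l m x => [|e IH] l m x lF.
    rewrite addn0 => szl Hm Hx; have Zx : VU x.
      move: x Hx; apply: homU_min => [|m1|i j v p _ Hv Hp|i j v w ijm Hv Hw].
      - exact: span_subspace.
      - by lia.
      - by apply: memVU; [exact: homV_sub Hv|exact: homU_sub Hp].
      - by rewrite (homVV0 i j) //; [exact: subspace0 (span_subspace _)|lia].
    apply: (skew_word mul _ _ fst (fun _ _ => tt) (fun _ => VU)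
      (fun _ => [set (0 : A)]) F n2 _ _ _ _ _ l tt) => //.
    - by move=> _; exact: zero_subspace.
    - by move=> a _ y /FH /homV_sub Va /VUU Uy; apply: memVU.
    - by move=> a _ y _ ->; rewrite linear0r.
    - move=> a b _ + /FH /homV_sub Va /FH /homV_sub Vb.
      apply: span_min => [|_ [t [u [Vt Uu ->]]]]; last by rewrite skew3 // addNr.
      apply: (subspace_preim (fun y => a.1 ** (b.1 ** y) + b.1 ** (a.1 ** y))).
        by move=> c y z; rewrite !linearPr scalerDr addrACA.
      exact: zero_subspace.
  have lw := subspace_preim (mul_word mul fst l) _ (mul_word_linear mul _ fst l)
    zero_subspace.
  rewrite mulSn => szl Hm; move: x.
  apply: homU_min => [||i j v p ijm Hv Hp|i j v w ijm Hv Hw].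
  - exact: lw.
  - by lia.
  - have [lei|lti] := leqP nV i.
      by rewrite (HV _ _ lei Hv) linear0l; exact: subspace0 lw.
    have Fv := Fspan _ _ lti Hv; move: v Fv {Hv}; apply: span_min => [|v Fv].
      exact: (subspace_mulr _ p lw).
    have := IH (rcons l (v, i)) j p.
    rewrite /mul_word !foldr_rcons size_rcons addSnnS /=; apply=> //; last by lia.
    by move=> a; rewrite mem_rcons inE => /predU1P[->|/lF].
  - by rewrite (homVV0 i j) //; [exact: subspace0 lw|lia].
exists (nV.*2 + 2 + (size F).+1 * nV)%N => n x nn Hx.
by apply: (main (size F).+1 [::] n x).
Qed.

Lemma hom_eq0 :
  (forall v w t x, V v -> V w -> V t -> U x ->
    v ** (w ** (t ** x)) = - (w ** (v ** (t ** x)))) ->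
  exists n1, forall b n x, (n1 <= n)%N -> homog b n x -> x = 0.
Proof.
move=> /homU_eq0[m1 H1]; have [m2 H2] := homV_eq0.
exists (m1 + m2)%N => -[] n x Hn.
  by apply: H1; apply: leq_trans Hn; exact: leq_addr.
by apply: H2; apply: leq_trans Hn; exact: leq_addl.
Qed.

End PeirceFiltration.

(** * Finite dimension from a finite spanning list *)

Section FiniteDimension.
Context {K : fieldType} {A : lmodType K}.

Let spans n (s : 'I_n -> A) : Prop :=
  forall x, exists c : 'rV[K]_n, x = \sum_i c 0 i *: s i.

Lemma span_spans (l : seq A) : (forall x, linear_span [set y | y \in l] x) ->
  spans (size l) (fun i => l`_i).
Proof.
move=> Hl x; move: x (Hl x); apply: span_min => [|x /(nthP 0)[i il <-]].
  split; first by exists 0; rewrite big1 // => i _; rewrite mxE scale0r.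
  move=> a x y [c ->] [d ->]; exists (a *: c + d); rewrite scaler_sumr -big_split /=.
  by apply: eq_bigr => i _; rewrite !mxE scalerDl scalerA.
exists (delta_mx 0 (Ordinal il)); rewrite (bigD1 (Ordinal il)) //= big1 => [|j ji].
  by rewrite mxE !eqxx scale1r addr0.
by rewrite mxE (negPf ji) andbF scale0r.
Qed.

(** A spanning family of least size is independent, so its coordinates give a linear bijection with
    row vectors. *)
Lemma span_finite_dimensional (l : seq A) :
  (forall x, linear_span [set y | y \in l] x) -> finite_dimensional A.
Proof.
move=> /span_spans Hl.
have exP : exists n, `[< exists s : 'I_n -> A, spans n s >].
  by exists (size l); apply/asboolP; exists (fun i => l`_i).
case: (ex_minnP exP) => n /asboolP[s Hs] minn; exists n; constructor.
pose f (c : 'rV[K]_n) := \sum_i c 0 i *: s i.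
have lf a c d : f (a *: c + d) = a *: f c + f d.
  rewrite /f scaler_sumr -big_split /=.
  by apply: eq_bigr => i _; rewrite !mxE scalerDl scalerA.
have kerf c : f c = 0 -> c = 0.
  move=> fc; apply: contrapT => /eqP/rV0Pn[k ck].
  case: n s Hs minn @f c lf fc k ck => [|n] s Hs minn f c lf fc k ck; first by case: k ck.
  suff /minn : `[< exists s : 'I_n -> A, spans n s >] by rewrite ltnn.
  apply/asboolP; exists (fun j => s (lift k j)) => x; have [d Hd] := Hs x.
  (* A multiple of the relation [c] cancels coordinate [k], so the family without [s k] still spans,
     against minimality. *)
  pose d' := - (d 0 k / c 0 k) *: c + d.
  have d'k : d' 0 k = 0 by rewrite !mxE mulNr mulfVK // addNr.
  exists (\row_j d' 0 (lift k j)).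
  have -> : x = f d' by rewrite lf fc scaler0 add0r.
  rewrite /f (bigD1_ord k) //= d'k scale0r add0r.
  by apply: eq_bigr => j _; rewrite !mxE.
have injf : injective f.
  move=> c d fcd; apply/subr0_eq/kerf.
  by rewrite addrC -scaleN1r lf fcd scaleN1r addNr.
have [g fg] := choice Hs.
have gK x : f (g x) = x by rewrite /f -fg.
exists g; last by exists f => x; [exact: gK|apply: injf; exact: gK].
by move=> a x y; apply: injf; rewrite lf !gK.
Qed.

End FiniteDimension.

(** * Identities between the Peirce components *)

Section BernsteinIdentities.
Context {K : fieldType} {A : lmodType K}.
Context (mul : {bilinear A -> A -> A}) (omega : {scalar A}) (e : A).
Context (K2 : 2%N \notin [pchar K]) (K3 : 3%N \notin [pchar K]).
Context (bA : bernstein mul omega) (e0 : e != 0) (ee : idempotent_elt mul e).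
Local Notation "x ** y" := (mul x y) (at level 40, left associativity).
Local Notation U := (peirceU mul e).
Local Notation V := (peirceV mul e).

Lemma char_neq2 : 2 != 0 :> K. Proof. by move: K2; rewrite inE /=. Qed.
Let n3 : 3 != 0 :> K. Proof. by move: K3; rewrite inE /=. Qed.
Let mC : commutative mul. Proof. by case: bA. Qed.

Lemma divn_eq0 n (x : A) : n%:R != 0 :> K -> x *+ n = 0 -> x = 0.
Proof.
by move=> n0; rewrite -scaler_nat => /eqP; rewrite scaler_eq0 (negPf n0) => /eqP.
Qed.

(** Separates the even part [a] and the odd part [b] of an identity that survives a change of
    sign. *)
Lemma parity_eq0 (a b : A) : a + b = 0 -> a - b = 0 -> a = 0 /\ b = 0.
Proof.
move=> ab /subr0_eq ba; move: ab; rewrite ba -mulr2n => /(divn_eq0 _ _ char_neq2) b0.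
by split.
Qed.

Lemma polarize (S : set A) (f : A -> A -> A) : is_subspace S ->
  (forall x y z, f (x + y) z = f x z + f y z) ->
  (forall x y z, f x (y + z) = f x y + f x z) ->
  (forall x, S x -> f x x = 0) -> forall x y, S x -> S y -> f x y + f y x = 0.
Proof.
move=> HS fDl fDr f0 x y Sx Sy; have := f0 _ (subspaceD _ _ _ HS Sx Sy).
by rewrite fDl !fDr !f0 // add0r addr0.
Qed.

Lemma peirceU_subspace : is_subspace U.
Proof.
split; rewrite /peirceU /=; first by rewrite linear0r mul0rn.
by move=> a x y Hx Hy; rewrite linearPr mulrnDl scalerMnr Hx Hy.
Qed.

Lemma peirceV_subspace : is_subspace V.
Proof.
split; rewrite /peirceV /=; first by rewrite linear0r.
by move=> a x y Hx Hy; rewrite linearPr Hx Hy scaler0 addr0.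
Qed.

Lemma peirceUV0 x : U x -> V x -> x = 0.
Proof. by rewrite /peirceU /peirceV /= => Ux Vx; rewrite -Ux Vx mul0rn. Qed.

Lemma omega_peirce u v : U u -> V v -> omega (u + v) = 0.
Proof.
move=> Uu Vv; have [_ _ E] := bernstein_peirce K2 K3 bA e0 ee.
have : alg_ker omega (u + v) by rewrite E; exists u, v.
by [].
Qed.

(* Compare the parts of [(x ^ 2) ^ 2 = x ^ 2], x = e + u + v, that are even and
   odd in (u, v), and then those of degree 2 and 4. *)
Lemma bernstein_homogeneous u v : U u -> V v -> let s := (u + v) ** (u + v) in
  [/\ u ** s = 0, s ** s = 0 & (e ** s) *+ 2 + u ** u = s].
Proof.
have oe : omega e = 1 by exact: bernstein_omega_idem bA e0 ee.
have [_ oM _ B] := bA.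
have H u1 v1 : U u1 -> V v1 -> let s := (u1 + v1) ** (u1 + v1) in
    ((e ** s) *+ 2 + u1 ** u1 - s + s ** s) + (u1 ** s) *+ 2 = 0.
  move=> Uu Vv s; have := omega_peirce _ _ Uu Vv.
  have : (e ** (u1 + v1)) *+ 2 = u1.
    by rewrite linearDr /= (_ : e ** v1 = 0) // addr0.
  rewrite {}/s; move: (u1 + v1) => y ey oy; set s := y ** y; have := B (e + y).
  have -> : omega (e + y) = 1 by rewrite linearD /= oy addr0.
  rewrite expr1n scale1r.
  have -> : (e + y) ** (e + y) = e + (u1 + s).
    by rewrite linearDl !linearDr /= ee [y ** e]mC -ey mulr2n !addrA.
  rewrite linearDl linearDr /= ee [(u1 + s) ** (e + _)]linearDr /= [(u1 + s) ** e]mC.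
  rewrite -addrA => /addrI; rewrite addrA -mulr2n.
  rewrite linearDl !linearDr /= [s ** u1]mC mulrnDl (_ : _ *+ 2 = u1) // -addrA => /addrI E.
  apply/eqP; rewrite -(subrr s) -[in X in _ == X - _]E mulr2n; apply/eqP.
  by rewrite [LHS](AC (4*2) (1*((2*5)*(6*4))*3))%AC.
move=> Uu Vv s; have Hs := H u v Uu Vv.
have HN : ((e ** s) *+ 2 + u ** u - s + s ** s) - (u ** s) *+ 2 = 0.
  have := H (- u) (- v) (subspaceN _ _ peirceU_subspace Uu) (subspaceN _ _ peirceV_subspace Vv).
  by rewrite -opprD linearNl !linearNr /= !linearNl !opprK mulNrn.
have [X0 /(divn_eq0 _ _ char_neq2) us0] := parity_eq0 _ _ Hs HN.
(* Doubling [u] and [v] multiplies [s] by 4 and [s s] by 16. Subtracting four times the original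
   identity leaves [12 (s s) = 0], and 12 is invertible. *)
have : e ** (s *+ 4) *+ 2 + (u ** u) *+ 4 - s *+ 4 + (s *+ 4) ** (s *+ 4) = 0.
  have := H (u *+ 2) (v *+ 2).
  rewrite -mulrnDl.
  have dbl z : (z *+ 2) ** (z *+ 2) = (z ** z) *+ 4.
    by rewrite (raddfMn (mul _)) /= mC (raddfMn (mul z)) /= -mulrnA.
  rewrite !dbl -/s; move=> Hd.
  have U2 : U (u *+ 2) by rewrite mulr2n; apply: (subspaceD _ _ _ peirceU_subspace).
  have V2 : V (v *+ 2) by rewrite mulr2n; apply: (subspaceD _ _ _ peirceV_subspace).
  have := Hd U2 V2.
  by rewrite /= (raddfMn (mul (u *+ 2))) /= [u *+ 2 ** s]mC (raddfMn (mul s)) /= [s ** u]mC us0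
    !mul0rn addr0.
have -> : (s *+ 4) ** (s *+ 4) = (s ** s) *+ 4 + (s ** s) *+ 12.
  by rewrite (raddfMn (mul _)) /= mC (raddfMn (mul s)) /= -mulrnA -mulrnDr.
rewrite (raddfMn (mul e)) /= -mulrnA (mulrnA _ 2 4) -mulrnDl -mulrnBl addrA -mulrnDl X0.
rewrite mul0rn add0r => /divn_eq0 ss0.
have {}ss0 : s ** s = 0.
  by apply: ss0; rewrite -[12%N]/(2 * 2 * 3)%N !natrM !mulf_neq0 // char_neq2.
by split=> //; apply/subr0_eq; rewrite -X0 ss0 addr0.
Qed.

Let addl x y z : (x + y) ** z = x ** z + y ** z. Proof. by rewrite linearDl. Qed.
Let oppl x y : (- x) ** y = - (x ** y). Proof. by rewrite linearNl. Qed.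
Let oppr x y : x ** (- y) = - (x ** y). Proof. by rewrite linearNr. Qed.
Let addr x y z : z ** (x + y) = z ** x + z ** y. Proof. by rewrite linearDr. Qed.

Lemma peirce_square u : U u ->
  [/\ V (u ** u), u ** (u ** u) = 0 & (u ** u) ** (u ** u) = 0].
Proof.
move=> Uu; have := bernstein_homogeneous _ _ Uu (subspace0 _ peirceV_subspace).
rewrite addr0 => -[u3 u4 /eqP]; rewrite -[X in _ == X]add0r => /eqP/addIr.
by move=> /(divn_eq0 _ _ char_neq2) eu.
Qed.

Lemma peirce_squareV v : V v -> U (v ** v) /\ (v ** v) ** (v ** v) = 0.
Proof.
move=> Vv; have [_] := bernstein_homogeneous _ _ (subspace0 _ peirceU_subspace) Vv.
by rewrite add0r linear0l addr0.
Qed.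

Lemma half_mem (S : set A) x : is_subspace S -> S (x *+ 2) -> S x.
Proof.
move=> HS /(subspaceZ _ 2^-1 _ HS).
by rewrite -scaler_nat scalerA mulVf ?scale1r // char_neq2.
Qed.

Lemma mul_sqrD x y : (x + y) ** (x + y) = x ** x + (x ** y) *+ 2 + y ** y.
Proof. by rewrite linearDl !linearDr /= [y ** x]mC mulr2n !addrA. Qed.

Lemma peirceUU u w : U u -> U w -> V (u ** w).
Proof.
move=> Uu Uw; have HV := peirceV_subspace; apply: (half_mem _ _ HV).
have [+ _ _] := peirce_square _ (subspaceD _ _ _ peirceU_subspace Uu Uw).
have [Vu _ _] := peirce_square _ Uu; have [Vw _ _] := peirce_square _ Uw.
rewrite mul_sqrD => Vs; rewrite -[_ *+ 2](addrK (u ** u)) [_ + u ** u]addrC.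
apply: (subspaceB _ _ _ HV) => //.
by rewrite -[X in V X](addrK (w ** w)); apply: (subspaceB _ _ _ HV).
Qed.

Lemma peirceVV v w : V v -> V w -> U (v ** w).
Proof.
move=> Vv Vw; have HU := peirceU_subspace; apply: (half_mem _ _ HU).
have [+ _] := peirce_squareV _ (subspaceD _ _ _ peirceV_subspace Vv Vw).
have [Uv _] := peirce_squareV _ Vv; have [Uw _] := peirce_squareV _ Vw.
rewrite mul_sqrD => Us; rewrite -[_ *+ 2](addrK (v ** v)) [_ + v ** v]addrC.
apply: (subspaceB _ _ _ HU) => //.
by rewrite -[X in U X](addrK (w ** w)); apply: (subspaceB _ _ _ HU).
Qed.

(** In the last equation of [bernstein_homogeneous], [e] kills [u u] and twice [e] fixes [v v];
    after cancellation only the condition on [2 (u v)] remains. *)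
Lemma peirceVU v u : V v -> U u -> U (v ** u).
Proof.
move=> Vv Uu; have [_ _] := bernstein_homogeneous _ _ Uu Vv.
have [Vu _ _] := peirce_square _ Uu; have [Uv _] := peirce_squareV _ Vv.
rewrite mul_sqrD 2!addr (_ : e ** (u ** u) = 0) // add0r.
rewrite mulrnDl (_ : (e ** (v ** v)) *+ 2 = v ** v) // addrAC => /addIr.
rewrite addrC => /addrI; rewrite mC => H.
apply: (half_mem _ _ peirceU_subspace).
by rewrite /peirceU /= [v ** u]mC [e ** _]mC.
Qed.

(** Since [u (u u) = 0], the identity [u s = 0] reads [2 u (u v) + u (v v) = 0], with one term odd
    and one even in [v]. *)
Lemma peirce_mixed u v : U u -> V v -> u ** (u ** v) = 0 /\ u ** (v ** v) = 0.
Proof.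
move=> Uu Vv; have [+ _ _] := bernstein_homogeneous _ _ Uu Vv.
have [+ _ _] := bernstein_homogeneous _ _ Uu (subspaceN _ _ peirceV_subspace Vv).
have [_ u3 _] := peirce_square _ Uu.
rewrite !mul_sqrD linearNl !linearNr /= opprK mulNrn !addr linearNr /= u3 !add0r.
rewrite (raddfMn (mul u)) /= => H1 H2.
rewrite addrC in H1; rewrite addrC in H2.
by have [-> /(divn_eq0 _ _ char_neq2)] := parity_eq0 _ _ H2 H1.
Qed.

(** The part of [s s = 0] even in [v] is [(2 u v) (2 u v) + 2 (u u) (v v) = 0]. Its first term lies
    in V and its second in U, so both vanish. *)
Lemma peirce_sqrUV u v : U u -> V v -> (u ** v) ** (u ** v) = 0.
Proof.
move=> Uu Vv; have [_ + _] := bernstein_homogeneous _ _ Uu Vv.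
have [_ + _] := bernstein_homogeneous _ _ Uu (subspaceN _ _ peirceV_subspace Vv).
have [Va _ aa] := peirce_square _ Uu; have [Uc cc] := peirce_squareV _ Vv.
rewrite (mul_sqrD u v) (mul_sqrD u (- v)) linearNl !linearNr /= opprK mulNrn.
have Ub : U ((u ** v) *+ 2)
  by rewrite mC mulr2n; apply: (subspaceD _ _ _ peirceU_subspace); apply: peirceVU.
move: (u ** u) (v ** v) Va aa Uc cc => a c Va aa Uc cc.
move Eb : ((u ** v) *+ 2) Ub => b Ub.
have exp d : (a + d + c) ** (a + d + c) =
    (d ** d + (a ** c) *+ 2) + ((a ** d) *+ 2 + (d ** c) *+ 2).
  rewrite 2!mul_sqrD aa cc addr0 add0r addl mulrnDl.
  by rewrite [LHS](AC (2*2) ((2*3)*(1*4)))%AC.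
rewrite !exp linearNl !linearNr /= linearNl opprK !mulNrn -opprD => H1 H2.
have [H _] := parity_eq0 _ _ H2 H1.
have Vbb : V (b ** b) by exact: peirceUU.
have Uac : U ((a ** c) *+ 2).
  by rewrite mulr2n; apply: (subspaceD _ _ _ peirceU_subspace); apply: peirceVU.
have : b ** b = 0.
  apply: peirceUV0 => //; move/eqP: H; rewrite addr_eq0 => /eqP ->.
  exact: subspaceN _ _ peirceU_subspace Uac.
rewrite -Eb (raddfMn (mul _)) /= mC (raddfMn (mul _)) /= -mulrnA.
by apply: divn_eq0; rewrite natrM mulf_neq0 // char_neq2.
Qed.

Lemma peirce_skewU p q v : U p -> U q -> V v -> p ** (v ** q) = - (q ** (v ** p)).
Proof.
move=> Up Uq Vv; apply/eqP; rewrite -addr_eq0; apply/eqP.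
apply: (polarize U (fun p q => p ** (v ** q))) => //.
- exact: peirceU_subspace.
- by move=> x y z; rewrite addr addr.
- by move=> x Ux; rewrite [v ** x]mC; case: (peirce_mixed _ _ Ux Vv).
Qed.

Lemma peirce_annVV p v w : U p -> V v -> V w -> p ** (v ** w) = 0.
Proof.
move=> Up Vv Vw; apply: (divn_eq0 _ _ char_neq2).
rewrite mulr2n [in X in _ + X](mC v).
apply: (polarize V (fun v w => p ** (v ** w))) => //.
- exact: peirceV_subspace.
- by move=> x y z; rewrite addl addr.
- by move=> x y z; rewrite addr addr.
- by move=> x Vx; case: (peirce_mixed _ _ Up Vx).
Qed.

(** Polarisation of [p (x (x q)) = 0]. By [peirce_skewU] the left side is [- (x q) (x p)], which
    vanishes by polarising [peirce_sqrUV]. *)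
Lemma peirce_skewV p q v w : U p -> U q -> V v -> V w ->
  p ** (v ** (w ** q)) = - (p ** (w ** (v ** q))).
Proof.
move=> Up Uq Vv Vw; apply/eqP; rewrite -addr_eq0; apply/eqP.
apply: (polarize V (fun v w => p ** (v ** (w ** q)))) => //.
- exact: peirceV_subspace.
- by move=> x y z; rewrite addl addr.
- by move=> x y z; rewrite addl addr addr.
move=> x Vx; rewrite peirce_skewU //; last exact: peirceVU.
have /eqP : (q ** x) ** (p ** x) + (p ** x) ** (q ** x) = 0.
  apply: (polarize U (fun a b => (a ** x) ** (b ** x))) => //.
  - exact: peirceU_subspace.
  - by move=> a b c; rewrite addl addl.
  - by move=> a b c; rewrite addl addr.
  - by move=> a Ua; apply: peirce_sqrUV.
rewrite [p ** x ** _]mC -mulr2n => /eqP/(divn_eq0 _ _ char_neq2).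
by rewrite [q ** x]mC [p ** x]mC => ->; rewrite oppr0.
Qed.

Lemma peirce_cube p q r : U p -> U q -> U r ->
  p ** (q ** r) + q ** (r ** p) + r ** (p ** q) = 0.
Proof.
have fD x y : (x + y) ** ((x + y) ** (x + y)) = x ** (x ** x) + y ** (y ** y) +
    ((y ** (x ** x) + (x ** (x ** y) + x ** (x ** y))) +
     (x ** (y ** y) + (y ** (y ** x) + y ** (y ** x)))).
  rewrite mul_sqrD mulr2n !addl !addr [y ** x]mC.
  by rewrite [LHS](AC ((1*2*1)*(1*2*1)) ((1*8)*((5*(2*3))*(4*(6*7)))))%AC.
(* First linearisation of [u (u u) = 0]: the part linear in [y], isolated by replacing [y] with
   [- y]. Putting [x = p + r] then linearises fully. *)
have H x y : U x -> U y -> y ** (x ** x) + (x ** (x ** y) + x ** (x ** y)) = 0.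
  move=> Ux Uy; have HU := peirceU_subspace; have Uy' := subspaceN _ _ HU Uy.
  have f0 z : U z -> z ** (z ** z) = 0 by move=> /peirce_square[].
  have := f0 _ (subspaceD _ _ _ HU Ux Uy'); have := f0 _ (subspaceD _ _ _ HU Ux Uy).
  rewrite !fD !f0 // addr0 !add0r => H1.
  rewrite !(oppl, oppr) !opprK -!opprD.
  by rewrite addrC in H1; rewrite addrC => /(parity_eq0 _ _ H1)[].
move=> Up Uq Ur; have HU := peirceU_subspace.
have := H _ _ (subspaceD _ _ _ HU Up Ur) Uq.
rewrite mul_sqrD mulr2n !addl !addr.
rewrite [LHS](AC ((1*2*1)*((2*2)*(2*2)))
  (((1*(5*9))*(4*(8*12)))*(((6*2)*7)*((10*3)*11))))%AC /= !H // !add0r -mulr2n.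
by move=> /(divn_eq0 _ _ char_neq2); rewrite [r ** q]mC [p ** r]mC.
Qed.

End BernsteinIdentities.

(** * Generators in U and V, and the consequence of [L_x^3 = 0] *)

Section Assembly.
Context {K : fieldType} {A : lmodType K}.
Context (mul : {bilinear A -> A -> A}) (omega : {scalar A}) (e : A).
Context (K2 : 2%N \notin [pchar K]) (K3 : 3%N \notin [pchar K]).
Context (bA : bernstein mul omega) (e0 : e != 0) (ee : idempotent_elt mul e).
Local Notation "x ** y" := (mul x y) (at level 40, left associativity).
Local Notation U := (peirceU mul e).
Local Notation V := (peirceV mul e).

Lemma homogeneous_generators : finitely_generated mul -> exists gU gV : seq A,
  [/\ forall x, x \in gU -> U x, forall x, x \in gV -> V x &
      forall S, is_subalgebra mul S -> S e -> (forall x, x \in gU ++ gV -> S x) ->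
        forall x, S x].
Proof.
case=> G [/finite_seqP[s Gs] GT].
have [dec _ _] := bernstein_peirce K2 K3 bA e0 ee.
have [a Ha] := choice dec; have [u Hu] := choice Ha; have [v Hv] := choice Hu.
exists [seq u x | x <- s], [seq v x | x <- s]; split.
- by move=> _ /mapP[x _ ->]; case: (Hv x).
- by move=> _ /mapP[x _ ->]; case: (Hv x).
move=> S HS Se Sg x; have : [set: A] x by [].
rewrite -GT; apply; split=> // y; rewrite Gs /= => ys.
have [_ _ ->] := Hv y; case: HS => HS _.
apply: (subspaceD _ _ _ HS); last by apply: Sg; rewrite mem_cat map_f ?orbT.
by apply: (subspaceD _ _ _ HS); [exact: subspaceZ|apply: Sg; rewrite mem_cat map_f].
Qed.

(** After expanding [L_(x + v)^3 t = 0], the Peirce identities leave [x (v (x t)) + v (v (x t)) + v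
    (v (v t)) = 0]. Its part even in [v] is [v (v (t x)) = 0], which is then polarised in [v]. *)
Lemma peirce_skew3 : (forall x y, alg_ker omega x -> alg_ker omega y ->
    iter 3 (mul x) y = 0) ->
  forall v w t x, V v -> V w -> V t -> U x ->
    v ** (w ** (t ** x)) = - (w ** (v ** (t ** x))).
Proof.
move=> L3 v w t x Vv Vw Vt Ux; apply/eqP; rewrite -addr_eq0; apply/eqP.
have addl a b c : (a + b) ** c = a ** c + b ** c by rewrite linearDl.
have addr a b c : c ** (a + b) = c ** a + c ** b by rewrite linearDr.
have oppl a b : (- a) ** b = - (a ** b) by rewrite linearNl.
have oppr a b : a ** (- b) = - (a ** b) by rewrite linearNr.
apply: (polarize V (fun v w => v ** (w ** (t ** x)))) => // {v w Vv Vw}.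
- exact: peirceV_subspace.
- by move=> a b c; rewrite !(addl, addr).
move=> v Vv; have mC : commutative mul by case: bA.
have UN u : U u -> alg_ker omega u.
  move=> Uu; rewrite /alg_ker /= -[u]addr0.
  exact: (omega_peirce mul omega e) (subspace0 _ (peirceV_subspace mul e)).
have VN u : V u -> alg_ker omega u.
  move=> Vu; rewrite /alg_ker /= -[u]add0r.
  exact: (omega_peirce mul omega e) (subspace0 _ (peirceU_subspace mul e)) _.
have ND a b : alg_ker omega a -> alg_ker omega b -> alg_ker omega (a + b).
  by rewrite /alg_ker /= linearD /= => -> ->; rewrite addr0.
have NN a : alg_ker omega a -> alg_ker omega (- a).
  by rewrite /alg_ker /= linearN /= => ->; rewrite oppr0.
have H1 := L3 _ _ (ND _ _ (UN _ Ux) (VN _ Vv)) (VN _ Vt).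
have H2 := L3 _ _ (ND _ _ (UN _ Ux) (NN _ (VN _ Vv))) (VN _ Vt).
move: H1 H2; rewrite /= !(addl, addr, oppl, oppr) !opprK => H1 H2.
have xxt : x ** (x ** t) = 0 by case: (peirce_mixed _ _ _ K2 K3 bA e0 ee _ _ Ux Vt).
have xvt : x ** (v ** t) = 0 by apply: (peirce_annVV _ _ _ K2 K3 bA e0 ee).
have xvvt : x ** (v ** (v ** t)) = 0.
  rewrite (peirce_skewU _ _ _ K2 K3 bA e0 ee) //; last exact: (peirceVV _ _ _ K2 K3 bA e0 ee).
  rewrite mC (peirce_annVV _ _ _ K2 K3 bA e0 ee) ?oppr0 //.
  by apply: (peirceVU _ _ _ K2 K3 bA e0 ee).
move: H1 H2; rewrite xxt xvt xvvt !linear0r oppr0 !(addr0, add0r) => H1 H2.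
rewrite [t ** x]mC.
apply: (proj1 (parity_eq0 K2 _ (x ** (v ** (x ** t)) + v ** (v ** (v ** t))) _ _)).
  by rewrite addrCA.
by rewrite opprD addrCA.
Qed.

End Assembly.

(** * Nilpotency and finite dimension *)

Theorem proposition7p9 (K : fieldType) (A : lmodType K)
    (mul : {bilinear A -> A -> A}) (omega : {scalar A}) (e : A)
    (K_infinite : infinite_set [set: K])
    (K_char2 : 2%N \notin [pchar K]) (K_char3 : 3%N \notin [pchar K])
    (A_bernstein : bernstein mul omega)
    (e_neq0 : e != 0) (e_idem : idempotent_elt mul e)
    (A_fg : finitely_generated mul)
    (L_cube0 : forall x y : A, alg_ker omega x -> alg_ker omega y ->
       iter 3 (mul x) y = 0) :
  finite_dimensional A /\ nilpotent_alg mul (alg_ker omega).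
Proof.
have [gU [gV [gUU gVV gen]]] := homogeneous_generators _ _ _
  K_char2 K_char3 A_bernstein e_neq0 e_idem A_fg.
have mC : commutative mul by case: A_bernstein.
pose U := peirceU mul e; pose V := peirceV mul e.
have HU : is_subspace U := peirceU_subspace mul e.
have HV : is_subspace V := peirceV_subspace mul e.
have n2 := char_neq2 K_char2.
pose hg := homog mul gU gV.
have mUU p q : U p -> U q -> V (mul p q) by apply: peirceUU K_char2 K_char3 A_bernstein _ _ _ _.
have mVU v p : V v -> U p -> U (mul v p) by apply: peirceVU K_char2 K_char3 A_bernstein _ _ _ _.
have mVV v w : V v -> V w -> U (mul v w) by apply: peirceVV K_char2 K_char3 A_bernstein _ _ _ _.
have [n0 hg0] : exists n0, forall b n x, (n0 <= n)%N -> hg b n x -> x = 0.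
  apply: (hom_eq0 mul gU gV U V n2 mC HU HV gUU gVV mUU mVU mVV).
  - exact: peirce_skewU K_char2 K_char3 A_bernstein e_neq0 e_idem.
  - exact: peirce_cube K_char2 K_char3 A_bernstein e_neq0 e_idem.
  - exact: peirce_annVV K_char2 K_char3 A_bernstein e_neq0 e_idem.
  - exact: peirce_skewV K_char2 K_char3 A_bernstein e_neq0 e_idem.
  - exact: peirce_skew3 K_char2 K_char3 A_bernstein e_neq0 e_idem L_cube0.
(* These subspaces multiply like powers of N and contain them: [tail 1] contains N, and [tail n0] is
   zero. *)
pose tail n := linear_span [set x | exists b m, (n <= m)%N /\ hg b m x].
have tail_sub n : is_subspace (tail n) by exact: span_subspace.
have hg_tail b m n x : (n <= m)%N -> hg b m x -> tail n x.
  by move=> nm Hx; apply: mem_span; exists b, m.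
have tail_mul i j x y : tail i x -> tail j y -> tail (i + j)%N (mul x y).
  move: x y; apply: span_mul => // x y [b [m [im Hx]]] [c [k [jk Hy]]].
  have mk : (i + j <= m + k)%N by exact: leq_add.
  case: b c Hx Hy => -[] Hx Hy.
  - exact: hg_tail _ _ _ _ mk (HomUU _ _ _ _ _ _ _ Hx Hy).
  - by rewrite mC; rewrite (addnC m) in mk; exact: hg_tail _ _ _ _ mk (HomVU _ _ _ _ _ _ _ Hy Hx).
  - exact: hg_tail _ _ _ _ mk (HomVU _ _ _ _ _ _ _ Hx Hy).
  - exact: hg_tail _ _ _ _ mk (HomVV _ _ _ _ _ _ _ Hx Hy).
have tail_le m n x : (m <= n)%N -> tail n x -> tail m x.
  move=> mn; move: x; apply: span_min => // x [b [k [nk Hx]]].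
  exact: hg_tail _ _ _ _ (leq_trans mn nk) Hx.
have tail0 x : tail n0 x -> x = 0.
  apply: (span_min _ [set (0 : A)]); first exact: zero_subspace.
  by move=> {}x [b [m [nm Hx]]]; exact: hg0 _ _ _ nm Hx.
have tail_e x : tail 1 x -> tail 1 (mul e x).
  move: x; apply: span_min => [|x [[] [m [m1 Hx]]]].
  - exact: (subspace_preim (mul e) _ (mul_linearl mul e) (tail_sub 1%N)).
  - apply: (half_mem K_char2 _ _ (tail_sub 1%N)).
    have := homU_sub _ _ _ _ _ HU HV gUU gVV mUU mVU mVV _ _ Hx.
    by rewrite /U /peirceU /= => ->; exact: hg_tail _ _ _ _ m1 Hx.
  - have := homV_sub _ _ _ _ _ HU HV gUU gVV mUU mVU mVV _ _ Hx.
    by rewrite /V /peirceV /= => ->; exact: subspace0.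
(* [K e + tail 1] is a subalgebra containing [e] and the generators, because [e] acts as one half on
   U and as zero on V. *)
have decomp x : exists a y, tail 1 y /\ x = a *: e + y.
  move: x; apply: gen; first split.
  - split; first by exists 0, 0; split; [exact: subspace0|rewrite scale0r addr0].
    move=> a _ _ [b [y [Hy ->]]] [c [z [Hz ->]]]; exists (a * b + c), (a *: y + z).
    split; first by case: (tail_sub 1%N) => _; apply.
    by rewrite scalerDr scalerDl scalerA addrACA.
  - move=> _ _ [b [y [Hy ->]]] [c [z [Hz ->]]].
    exists (b * c), (b *: mul e z + (c *: mul e y + mul y z)); split.
      apply: (subspaceD _ _ _ (tail_sub 1%N)).
        by apply: (subspaceZ _ _ _ (tail_sub 1%N)); exact: tail_e.
      apply: (subspaceD _ _ _ (tail_sub 1%N)).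
        by apply: (subspaceZ _ _ _ (tail_sub 1%N)); exact: tail_e.
      exact: tail_le _ _ _ _ (tail_mul _ _ _ _ Hy Hz).
    rewrite linearDl !linearDr /= !linearZl_LR !linearZr_LR /= e_idem (mC y e).
    by rewrite scalerA !addrA.
  - by exists 1, 0; split; [exact: subspace0|rewrite scale1r addr0].
  - move=> x; rewrite mem_cat => Hx; exists 0, x; split; last by rewrite scale0r add0r.
    by case/orP: Hx => Hx; [apply: (hg_tail true 1%N)|apply: (hg_tail false 1%N)] => //;
      [exact: HomU|exact: HomV].
have omega_tail x : tail 1 x -> omega x = 0.
  apply: (span_min _ [set x | omega x = 0]).
    by split=> [|a y z] /=; rewrite ?linear0 // linearP /= => -> ->; rewrite mulr0 addr0.
  move=> {}x [[] [m [_ Hx]]] /=.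
    rewrite -[x]addr0.
    apply: (omega_peirce mul omega e) (subspace0 _ HV) => //.
    exact: (homU_sub _ _ _ _ _ HU HV gUU gVV mUU mVU mVV _ _ Hx).
  rewrite -[x]add0r; apply: (omega_peirce mul omega e) (subspace0 _ HU) _ => //.
  exact: (homV_sub _ _ _ _ _ HU HV gUU gVV mUU mVU mVV _ _ Hx).
have ker_tail x : alg_ker omega x -> tail 1 x.
  have [a [y [Hy ->]]] := decomp x.
  rewrite /alg_ker /= linearD linearZ /= (bernstein_omega_idem A_bernstein e_neq0 e_idem).
  by rewrite omega_tail // addr0 mulr1 => ->; rewrite scale0r add0r.
split; last first.
  (* The successor keeps the exponent positive even if [n0] is 0. *)
  exists n0.+1 => // x Hx; apply: tail0; apply: (tail_le _ n0.+1) => //.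
  elim: Hx => {x} [x Hx|i j x y _ _ _ Hx _ Hy|n|n a x y _ Hx _ Hy].
  - exact: ker_tail.
  - exact: tail_mul.
  - exact: subspace0.
  - by case: (tail_sub n) => _; apply.
(* Degrees from [n0] on contribute only zero, so [e] and spanning lists for the finitely many lower
   degrees span A. *)
have [l Hl] : exists l : seq A, forall b n x, (n < n0)%N -> hg b n x ->
    linear_span [set y | y \in l] x.
  elim: {hg0 tail0}n0 => [|n [l Hl]]; first by exists [::].
  have [l1 [_ H1]] := hom_fin mul gU gV true n.
  have [l2 [_ H2]] := hom_fin mul gU gV false n.
  exists (l ++ l1 ++ l2) => b m x; rewrite ltnS leq_eqVlt => /predU1P[->|lt] Hx.
    case: b Hx => [/H1|/H2]; apply: span_mono => z /= Hz; rewrite !mem_cat Hz ?orbT //.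
  by apply: span_mono (Hl _ _ _ lt Hx) => z /= Hz; rewrite mem_cat Hz.
apply: (span_finite_dimensional (e :: l)) => x; have [a [y [Hy ->]]] := decomp x.
have Hs := span_subspace [set y | y \in e :: l].
apply: (subspaceD _ _ _ Hs).
  by apply: (subspaceZ _ _ _ Hs); apply: mem_span; rewrite /= inE eqxx.
move: y Hy; apply: span_min => // y [b [m [_ Hy]]].
have [le|lt] := leqP n0 m; first by rewrite (hg0 _ _ _ le Hy); exact: subspace0.
by apply: span_mono (Hl _ _ _ lt Hy) => z /= Hz; rewrite inE Hz orbT.
Qed.
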